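(* Let $A$ be a finite abelian group. The irreducible characters of $C(A)$ and of $\mathrm{ASp}(A)$ have the common row parameters $$\bigsqcup_{[u]\in\mathrm{Sp}(V_A)\backslash V_A}\mathrm{Irr}(\mathrm{Sp}(V_A)_u),$$ and their conjugacy classes have the common column parameters $$\bigsqcup_{[T]\subseteq\mathrm{Sp}(V_A)}C_{\mathrm{Sp}(V_A)}(T)\backslash\widehat{F_T},$$ where $[T]$ runs over the conjugacy classes of $\mathrm{Sp}(V_A)$. Under these parameters, the two character tables agree entry by entry. Their common value in row $(u,\sigma)$ and column $(T,\ell)$ is $$\chi^{C(A)}_{(u,\sigma)}(T,\ell)=\chi^{\mathrm{ASp}(A)}_{(u,\sigma)}(T,\ell)=\sum_{x\in(\mathrm{Sp}(V_A)\cdot u)\cap F_T}\ell(x)\,\chi_\sigma(T_x^{-1}TT_x),$$ where for each $x\in\mathrm{Sp}(V_A)\cdot u$ an element $T_x\in\mathrm{Sp}(V_A)$ with $T_xu=x$ has been chosen.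
   Context: **Setting.** $A$ is a finite abelian group, written additively; $\widehat{A}=\mathrm{Hom}(A,U(1))$; $V_A=A\oplus\widehat{A}$ (written additively); $\widehat{V_A}=\mathrm{Hom}(V_A,U(1))$. Put $\beta_A((a,\chi),(b,\psi))=\chi(b)$ and $\omega_A(u,v)=\beta_A(u,v)\beta_A(v,u)^{-1}$; $\mathrm{Sp}(V_A)=\{T\in\mathrm{Aut}(V_A):\omega_A(Tu,Tv)=\omega_A(u,v)\ \forall u,v\}$. All representations are finite-dimensional over $\mathbb{C}$. **Projective Clifford group.** Let $\mathcal{H}=\mathbb{C}[A]$ with orthonormal basis $|b\rangle$, $b\in A$; for $v=(a,\chi)\in V_A$ let $W_v|b\rangle=\chi(b)|a+b\rangle$; $H(A)=\{zW_v:z\in U(1),v\in V_A\}$ and $C(A)=N_{U(\mathcal{H})}(H(A))/(U(1)\cdot I)$. Throughout, $C(A)$ is identified (by a known isomorphism) with the group of pairs $(T,\lambda)$, $T\in\mathrm{Aut}(V_A)$, $\lambda:V_A\to U(1)$ a function, satisfying $\lambda(u+v)\lambda(u)^{-1}\lambda(v)^{-1}=\beta_A(Tu,Tv)\beta_A(u,v)^{-1}$ for all $u,v$, with product $(T,\lambda)(S,\mu)=(TS,\lambda^S\mu)$, $\lambda^S(u)=\lambda(Su)$; $(T,\lambda)$ corresponds to the class of any unitary $U$ with $UW_uU^\dagger=\lambda(u)W_{Tu}$ for all $u$. Necessarily $T\in\mathrm{Sp}(V_A)$, and the projection to $\mathrm{Sp}(V_A)$ is onto (known). **Affine symplectic group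 and functor $\mathcal{F}$.** $\mathrm{ASp}(A)=\{(T,\chi):T\in\mathrm{Sp}(V_A),\chi\in\widehat{V_A}\}$ with $(T,\chi)(S,\psi)=(TS,\chi^S\psi)$, $\chi^S(v)=\chi(Sv)$. For a representation $(U,\pi)$ of $\mathrm{ASp}(A)$ put $U_v=\{\xi\in U:\pi(\mathrm{id},\chi)\xi=\chi(v)\xi\ \forall\chi\in\widehat{V_A}\}$ and $\rho(T)=\pi(T,1)$; then $U=\bigoplus_{v\in V_A}U_v$ and $\rho(T)U_v\subseteq U_{Tv}$. $\mathcal{F}(U)$ is the same vector space with $C(A)$-action $(T,\lambda)\cdot\xi=\lambda(v)\rho(T)\xi$ for $\xi\in U_v$. **Rows.** For $u\in V_A$ (one representative per $\mathrm{Sp}(V_A)$-orbit): $\mathrm{Sp}(V_A)_u=\mathrm{Stab}_{\mathrm{Sp}(V_A)}(u)$, $\mathrm{ASp}(A)_u=\mathrm{Sp}(V_A)_u\ltimes\widehat{V_A}$. For $\sigma\in\mathrm{Irr}(\mathrm{Sp}(V_A)_u)$ with character $\chi_\sigma$: $\widetilde\sigma_u(T,\chi)=\chi(u)\sigma(T)$ on $\mathrm{ASp}(A)_u$, $\Pi(u,\sigma)=\mathrm{Ind}_{\mathrm{ASp}(A)_u}^{\mathrm{ASp}(A)}(\widetilde\sigma_u)$, $\widetilde\Pi(u,\sigma)=\mathcal{F}(\Pi(u,\sigma))$. The parameter $(u,\sigma)$ labels the character $\chi^{\mathrm{ASp}(A)}_{(u,\sigma)}$ of $\Pi(u,\sigma)$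 and the character $\chi^{C(A)}_{(u,\sigma)}$ of $\widetilde\Pi(u,\sigma)$. **Columns.** For $T\in\mathrm{Sp}(V_A)$, $F_T=\ker(T-\mathrm{id})\leq V_A$, $\widehat{F_T}=\mathrm{Hom}(F_T,U(1))$, and the centralizer $C_{\mathrm{Sp}(V_A)}(T)$ acts on $\widehat{F_T}$ by $S\cdot\ell=\ell\circ S^{-1}$. One representative $T$ is chosen from each conjugacy class of $\mathrm{Sp}(V_A)$. The parameter $(T,\ell)$ labels the conjugacy class in $C(A)$ of any $(T,\lambda)$ with $\lambda|_{F_T}=\ell$ and the conjugacy class in $\mathrm{ASp}(A)$ of any $(T,\chi)$ with $\chi|_{F_T}=\ell$. *)

(* Defs.v *)
From HB Require Import structures.
From mathcomp Require Import all_boot all_order all_algebra all_fingroup.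
From mathcomp Require Import all_solvable all_field all_character.
From mathcomp Require Import ring.

Set Implicit Arguments.
Unset Strict Implicit.
Unset Printing Implicit Defensive.

Import Order.TTheory GRing.Theory Num.Theory.
Local Open Scope ring_scope.

(* Everything below is uniform in the field C : numClosedFieldType; the       *)
(* complex numbers are the instance C := R[i] for R : realType.               *)

Section UnityRoots.
Variable C : numClosedFieldType.

Definition unity_roots (n : nat) : seq C :=
  sval (closed_field_poly_normal ('X^n - 1)).

Lemma mem_unity_roots n x : (0 < n)%N -> x ^+ n = 1 -> x \in unity_roots n.
Proof.
move=> n0 xn; rewrite /unity_roots; case: closed_field_poly_normal => r /= hr.
rewrite -root_prod_XsubC.
have: root ('X^n - 1) x by rewrite rootE !hornerE ?hornerXn xn subrr.
by rewrite {1}hr rootZ // lead_coef_eq0 -size_poly_eq0 size_XnsubC.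
Qed.

Lemma norm_unity n (x : C) : (0 < n)%N -> x ^+ n = 1 -> `|x| = 1.
Proof.
move=> n0 xn; apply/eqP; rewrite -(pexpr_eq1 n0) ?normr_ge0 //.
by rewrite -normrX xn normr1.
Qed.

Lemma normC_neq0 (x : C) : `|x| = 1 -> x != 0.
Proof. by move=> h; rewrite -normr_eq0 h oner_eq0. Qed.

Variables (I : finType) (n : nat).

Definition unity_enc (f : {ffun I -> C}) :
  {ffun I -> option (seq_sub (unity_roots n))} := [ffun i => insub (f i)].
Definition unity_dec (g : {ffun I -> option (seq_sub (unity_roots n))}) :
  {ffun I -> C} := [ffun i => oapp (@ssval _ _) 0 (g i)].

Lemma unity_encK (f : {ffun I -> C}) : (0 < n)%N ->
  (forall i, f i ^+ n = 1) -> unity_dec (unity_enc f) = f.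
Proof.
move=> n0 hf; apply/ffunP => i; rewrite !ffunE insubT /=.
  exact: mem_unity_roots.
by [].
Qed.
End UnityRoots.

Lemma mulrn_card (B : finZmodType) (x : B) : x *+ #|B| = 0.
Proof.
rewrite -FinRing.zmodXgE -cardsT -[[set: B]]/(gval [set: B]%G).
by rewrite expg_cardG ?inE.
Qed.

Section Dual.
Variables (C : numClosedFieldType) (B : finZmodType).

Definition is_dual : pred {ffun B -> C} := [pred f : {ffun B -> C} |
  [forall x, `|f x| == 1] && [forall x, forall y, f (x + y) == f x * f y]].

Record dual := Dual { dual_fun :> {ffun B -> C}; _ : is_dual dual_fun }.

HB.instance Definition _ := [isSub for dual_fun].
HB.instance Definition _ := [Choice of dual by <:].

Lemma dual_norm (f : dual) x : `|f x| = 1.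
Proof. by case: f => f /= /andP[/forallP/(_ x)/eqP]. Qed.

Lemma dual_neq0 (f : dual) x : f x != 0.
Proof. exact/normC_neq0/dual_norm. Qed.

Lemma dualD (f : dual) x y : f (x + y) = f x * f y.
Proof. by case: f => f /= /andP[_ /forallP/(_ x)/forallP/(_ y)/eqP]. Qed.

Lemma dual0 (f : dual) : f 0 = 1.
Proof.
by apply: (mulfI (dual_neq0 f 0)); rewrite -dualD addr0 mulr1.
Qed.

Lemma dualN (f : dual) x : f (- x) = (f x)^-1.
Proof.
apply: (mulfI (dual_neq0 f x)).
by rewrite -dualD subrr dual0 divff ?dual_neq0.
Qed.

Lemma dualMn (f : dual) x n : f (x *+ n) = f x ^+ n.
Proof. by elim: n => [|n IH]; rewrite ?mulr0n ?dual0 // mulrS dualD IH exprS. Qed.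

Lemma card_zmod_gt0 : (0 < #|B|)%N. Proof. by apply/card_gt0P; exists 0. Qed.

Lemma dual_unity (f : dual) x : f x ^+ #|B| = 1.
Proof. by rewrite -dualMn mulrn_card dual0. Qed.

Lemma dualP (f g : dual) : f =1 g <-> f = g.
Proof. by split=> [h | -> //]; apply/val_inj/ffunP. Qed.

Let enc (f : dual) := unity_enc #|B| f.
Let dec g : option dual := insub (@unity_dec C B #|B| g).
Lemma dual_encK : pcancel enc dec.
Proof.
move=> f; rewrite /dec /enc unity_encK ?card_zmod_gt0 //; first exact: valK.
exact: dual_unity.
Qed.

HB.instance Definition _ := PCanIsCountable dual_encK.
HB.instance Definition _ : isFinite dual := PCanIsFinite dual_encK.

Lemma dual0_subproof : is_dual [ffun=> 1].
Proof.
apply/andP; split; apply/forallP => x; first by rewrite ffunE normr1.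
by apply/forallP => y; rewrite !ffunE mulr1.
Qed.

Lemma dualD_subproof (f g : dual) : is_dual [ffun x => f x * g x].
Proof.
apply/andP; split; apply/forallP => x.
  by rewrite ffunE normrM !dual_norm mulr1.
by apply/forallP => y; rewrite !ffunE !dualD mulrACA.
Qed.

Lemma dualN_subproof (f : dual) : is_dual [ffun x => (f x)^-1].
Proof.
apply/andP; split; apply/forallP => x.
  by rewrite ffunE normfV !dual_norm invr1.
by apply/forallP => y; rewrite !ffunE !dualD invfM.
Qed.

Definition dual_zero := Dual dual0_subproof.
Definition dual_add f g := Dual (dualD_subproof f g).
Definition dual_opp f := Dual (dualN_subproof f).

Lemma dual_addA : associative dual_add.
Proof. by move=> f g h; apply/dualP => x; rewrite /= !ffunE mulrA. Qed.
Lemma dual_addC : commutative dual_add.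
Proof. by move=> f g; apply/dualP => x; rewrite /= !ffunE mulrC. Qed.
Lemma dual_add0 : left_id dual_zero dual_add.
Proof. by move=> f; apply/dualP => x; rewrite /= !ffunE mul1r. Qed.
Lemma dual_addN : left_inverse dual_zero dual_opp dual_add.
Proof. by move=> f; apply/dualP => x; rewrite /= !ffunE mulVf ?dual_neq0. Qed.

HB.instance Definition _ :=
  GRing.isZmodule.Build dual dual_addA dual_addC dual_add0 dual_addN.

Lemma dual0E x : (0 : dual) x = 1. Proof. exact: (ffunE (fun=> 1)). Qed.
Lemma dualDE (f g : dual) x : (f + g) x = f x * g x.
Proof. exact: (ffunE (fun x => f x * g x)). Qed.
Lemma dualNE (f : dual) x : (- f) x = (f x)^-1.
Proof. exact: (ffunE (fun x => (f x)^-1)). Qed.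

End Dual.

Section Separation.
Variables (C : numClosedFieldType) (B : finZmodType).

Lemma dual_separates (b : B) : b != 0 -> exists f : dual C B, f b != 1.
Proof.
move=> b0; pose G := [set: B]%G; pose aG := regular_repr C G.
have Gin x : x \in G by rewrite inE.
have abG : abelian G by exact: FinRing.zmod_abelian.
have aGD x y : aG (x + y) = aG x *m aG y by rewrite -repr_mxM.
have aG0 : aG 0 = 1%:M by exact: repr_mx1.
have comm x y : aG x *m aG y = aG y *m aG x by rewrite -!aGD addrC.
pose D := aG b - 1%:M.
have D0 : D != 0.
  apply: contra b0 => /eqP/eqP; rewrite subr_eq0 => /eqP Db.
  have /subsetP/(_ b) := regular_mx_faithful C G.
  by move/(_ (introT (@rkerP _ _ _ _ aG b) (conj (Gin b) Db))); rewrite inE.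
have modD : mxmodule aG D.
  apply/mxmoduleP => x _; rewrite mulmxBl mul1mx comm -[X in _ - X]mulmx1.
  by rewrite -mulmxBr submxMl.
have [M simM MD] := dec_mxsimple_exists modD D0.
have rM : \rank M = 1%N.
  apply: (mxsimple_abelian_linear _ abG simM).
  exact: group_closure_closed_field.
have [modM nzM _] := simM.
pose v := nz_row M.
have v0 : v != 0 by rewrite nz_row_eq0.
have vM : (v <= M)%MS by exact: nz_row_sub.
have Mv : (M <= v)%MS.
  by rewrite -(geq_leqif (mxrank_leqif_sup vM)) rM rank_rV v0.
have act x : {a | v *m aG x = a *: v}.
  apply: sig_eqW; apply/sub_rVP; apply: submx_trans Mv.
  by apply: submx_trans (mxmoduleP modM x (Gin x)); exact: submxMr.
pose a x := sval (act x).
have aE x : v *m aG x = a x *: v by exact: svalP (act x).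
have vI (s t : C) : s *: v = t *: v -> s = t.
  move/eqP; rewrite -subr_eq0 -scalerBl scaler_eq0 (negbTE v0) orbF subr_eq0.
  by move/eqP.
have aD x y : a (x + y) = a x * a y.
  apply: vI; rewrite -aE aGD mulmxA aE -scalemxAl aE scalerA //.
have a0 : a 0 = 1 by apply: vI; rewrite -aE aG0 mulmx1 scale1r.
have aMn x n : a (x *+ n) = a x ^+ n.
  by elim: n => [|n IH]; rewrite ?mulr0n // mulrS aD IH exprS.
have an x : a x ^+ #|B| = 1 by rewrite -aMn mulrn_card.
have aP : is_dual [ffun x => a x].
  apply/andP; split; apply/forallP => x; rewrite ?ffunE.
    by apply/eqP; apply: norm_unity (an x); exact: card_zmod_gt0.
  by apply/forallP => y; rewrite !ffunE aD.
exists (Dual aP); rewrite /= ffunE; apply: contra v0 => /eqP ab1.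
have [w vw] := submxP (submx_trans vM MD).
pose N := \sum_(k < #|B|) aG (b *+ k).
have DN : D *m N = 0.
  rewrite /D /N mulmxBl mul1mx mulmx_sumr.
  under eq_bigr do rewrite -aGD -mulrS.
  rewrite -sumrB.
  rewrite -(big_mkord xpredT (fun k => aG (b *+ k.+1) - aG (b *+ k))).
  by rewrite telescope_sumr // mulr0n mulrn_card subrr.
have vN : v *m N = #|B|%:R *: v.
  rewrite /N mulmx_sumr; under eq_bigr do rewrite aE aMn ab1 expr1n scale1r.
  by rewrite sumr_const card_ord scaler_nat.
have: #|B|%:R *: v == 0 by rewrite -vN vw -mulmxA DN mulmx0.
by rewrite scaler_eq0 pnatr_eq0 -[_ == 0%N]negbK -lt0n card_zmod_gt0.
Qed.

Lemma sum_dual_B (f : dual C B) : f != 0 -> \sum_(x : B) f x = 0.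
Proof.
move=> f0; have [x fx] : exists x, f x != 1.
  apply/existsP; apply: contraNT f0; rewrite negb_exists => /forallP h.
  by apply/eqP/dualP => x; rewrite dual0E; apply/eqP; have := h x; rewrite negbK.
apply/eqP; move/negPf: fx => fx; apply: contraFT fx => s0.
rewrite -(inj_eq (mulIf s0)) mul1r; apply/eqP.
rewrite [RHS](reindex_inj (addrI x)) /= mulr_sumr.
by apply: eq_bigr => y _; rewrite dualD.
Qed.

Lemma sum_dual (x : B) : x != 0 -> \sum_(f : dual C B) f x = 0.
Proof.
move=> /dual_separates[g gx]; apply/eqP.
move/negPf: gx => gx; apply: contraFT gx => s0.
rewrite -(inj_eq (mulIf s0)) mul1r; apply/eqP.
rewrite [RHS](reindex_inj (addrI g)) /= mulr_sumr.
by apply: eq_bigr => y _; rewrite dualDE.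
Qed.

Lemma card_dual : #|{: dual C B}| = #|B|.
Proof.
apply/eqP; rewrite -(eqr_nat C); apply/eqP.
transitivity (\sum_(x : B) \sum_(f : dual C B) f x).
  rewrite (bigD1 0) //= [X in _ + X]big1 ?addr0 => [|x x0]; last exact: sum_dual.
  by under eq_bigr do rewrite dual0; rewrite sumr_const.
rewrite exchange_big (bigD1 0) //= [X in _ + X]big1 ?addr0 => [|f f0].
  by under eq_bigr do rewrite dual0E; rewrite sumr_const.
exact: sum_dual_B.
Qed.
End Separation.

Section Automorphisms.
Variable V : finZmodType.

(* The group law of {perm V} is the opposite one, (s * t)%g x = t (s x).      *)
Definition is_zaut : pred {perm V} := [pred s : {perm V} |
  [forall u, forall v, s (u + v) == s u + s v]].

Record zaut := ZAut { zaut_perm :> {perm V}; _ : is_zaut zaut_perm }.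

HB.instance Definition _ := [isSub for zaut_perm].
HB.instance Definition _ := [Finite of zaut by <:].

Lemma zautD (T : zaut) u v : T (u + v) = T u + T v.
Proof. by case: T => T /= /forallP/(_ u)/forallP/(_ v)/eqP. Qed.

Lemma zautP (T S : zaut) : T =1 S <-> T = S.
Proof. by split=> [h | -> //]; apply/val_inj/permP. Qed.

Lemma zaut1_subproof : is_zaut 1%g.
Proof. by apply/forallP => u; apply/forallP => v; rewrite !perm1. Qed.

Lemma zautM_subproof (T S : zaut) : is_zaut (zaut_perm S * zaut_perm T)%g.
Proof.
by apply/forallP => u; apply/forallP => v; rewrite !permM !zautD.
Qed.

Lemma zautV_subproof (T : zaut) : is_zaut (zaut_perm T)^-1%g.
Proof.
apply/forallP => u; apply/forallP => v; apply/eqP/(@perm_inj _ T).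
by rewrite zautD !permKV.
Qed.

Definition zaut_one := ZAut zaut1_subproof.
Definition zaut_mul T S := ZAut (zautM_subproof T S).
Definition zaut_inv T := ZAut (zautV_subproof T).

Lemma zaut_mulA : associative zaut_mul.
Proof. by move=> T S R; apply/zautP => x; rewrite /= !permM. Qed.
Lemma zaut_mul1 : left_id zaut_one zaut_mul.
Proof. by move=> T; apply/zautP => x; rewrite /= permM perm1. Qed.
Lemma zaut_mulV : left_inverse zaut_one zaut_inv zaut_mul.
Proof. by move=> T; apply/zautP => x; rewrite /= permM permK perm1. Qed.

HB.instance Definition _ :=
  Finite_isGroup.Build zaut zaut_mulA zaut_mul1 zaut_mulV.

Lemma zaut1E x : (1%g : zaut) x = x. Proof. exact: perm1. Qed.
Lemma zautME (T S : zaut) x : (T * S)%g x = T (S x). Proof. exact: permM. Qed.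
Lemma zautK (T : zaut) : cancel T (T^-1)%g. Proof. exact: permK. Qed.
Lemma zautKV (T : zaut) : cancel (T^-1)%g T. Proof. exact: permKV. Qed.

Lemma zaut0 (T : zaut) : T 0 = 0.
Proof. by apply: (addrI (T 0)); rewrite -zautD !addr0. Qed.

Lemma zautN (T : zaut) x : T (- x) = - T x.
Proof. by apply: (addrI (T x)); rewrite -zautD !subrr zaut0. Qed.

Definition fixed_by (T : zaut) : {pred V} := fun v => T v == v.

(* F_T = ker (T - id).                                                        *)
Record fixV (T : zaut) := FixV { fixV_val : V; _ : fixV_val \in fixed_by T }.

Lemma fixed_by_zmod_closed T : zmod_closed (fixed_by T).
Proof.
split=> [|u v]; rewrite !unfold_in ?zaut0 // => /eqP uT /eqP vT.
by rewrite zautD zautN uT vT.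
Qed.
HB.instance Definition _ T :=
  GRing.isZmodClosed.Build V (fixed_by T) (fixed_by_zmod_closed T).
HB.instance Definition _ T := [isSub for @fixV_val T].
HB.instance Definition _ T := [Finite of fixV T by <:].
HB.instance Definition _ T := [SubChoice_isSubZmodule of fixV T by <:].

(* The action of S on F_T. The default value of insubd is never taken when S  *)
(* centralizes T, see fix_actE.                                               *)
Definition fix_act (T S : zaut) (x : fixV T) : fixV T := insubd x (S (val x)).

Lemma fix_actE (T S : zaut) (x : fixV T) :
  S \in 'C[T]%g -> val (fix_act S x) = S (val x).
Proof.
move=> /cent1P cTS; rewrite /fix_act val_insubd ifT //.
rewrite unfold_in -zautME -cTS zautME.
by have := valP x; rewrite unfold_in => /eqP ->.
Qed.

End Automorphisms.

Section Groups.
Variables (C : numClosedFieldType) (A : finZmodType).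

HB.instance Definition _ := Finite.on (A * dual C A)%type.
Definition VA : finZmodType := (A * dual C A)%type.
Definition beta (u v : VA) : C := v.2 u.1.
Definition omega (u v : VA) : C := beta u v * (beta v u)^-1.

Lemma beta_norm u v : `|beta u v| = 1. Proof. exact: dual_norm. Qed.
Lemma beta_neq0 u v : beta u v != 0. Proof. exact: dual_neq0. Qed.
Lemma betaDl u v w : beta (u + v) w = beta u w * beta v w.
Proof. exact: dualD. Qed.
Lemma betaDr u v w : beta u (v + w) = beta u v * beta u w.
Proof. exact: dualDE. Qed.
Lemma beta0l w : beta 0 w = 1. Proof. exact: dual0. Qed.
Lemma beta0r w : beta w 0 = 1. Proof. exact: dual0E. Qed.
Lemma betaMnl u w n : beta (u *+ n) w = beta u w ^+ n.
Proof.
by elim: n => [|n IH]; rewrite ?mulr0n ?beta0l // mulrS betaDl IH exprS.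
Qed.

Definition Sp : {set zaut VA} :=
  [set T : zaut VA | [forall u, forall v, omega (T u) (T v) == omega u v]].

Lemma SpP (T : zaut VA) :
  reflect (forall u v, omega (T u) (T v) = omega u v) (T \in Sp).
Proof.
rewrite inE; apply: (iffP forallP) => [h u v | h u].
  by have /forallP/(_ v)/eqP := h u.
by apply/forallP => v; apply/eqP.
Qed.

Lemma Sp_group_set : group_set Sp.
Proof.
apply/group_setP; split=> [|T S /SpP hT /SpP hS]; apply/SpP => u v.
  by rewrite !zaut1E.
by rewrite !zautME hT hS.
Qed.
Canonical Sp_group := Group Sp_group_set.

Definition SpOrbit (u : VA) : {set VA} :=
  [set (T : zaut VA) u | T in Sp].

Definition SpStab (u : VA) : {set zaut VA} :=
  [set T in Sp | (T : zaut VA) u == u].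

Lemma SpStab_group_set u : group_set (SpStab u).
Proof.
apply/group_setP; split=> [|T S]; first by rewrite inE group1 zaut1E /=.
move=> /setIdP[hT /eqP Tu] /setIdP[hS /eqP Su].
by rewrite inE groupM //= zautME Su Tu.
Qed.
Canonical SpStab_group u := Group (SpStab_group_set u).

(* chi ^ S = chi \o S                                                         *)
Lemma dual_comp_subproof (f : dual C VA) (S : zaut VA) :
  is_dual [ffun v => f (S v)].
Proof.
apply/andP; split; apply/forallP => x; first by rewrite ffunE dual_norm.
by apply/forallP => y; rewrite !ffunE zautD dualD.
Qed.
Definition dual_comp f S := Dual (dual_comp_subproof f S).

Lemma dual_compE f S v : dual_comp f S v = f (S v). Proof. exact: ffunE. Qed.

Record asp := ASp { asp_pair : zaut VA * dual C VA; _ : asp_pair.1 \in Sp }.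
HB.instance Definition _ := [isSub for asp_pair].
HB.instance Definition _ := [Finite of asp by <:].

Definition asp_lin (g : asp) : zaut VA := (asp_pair g).1.
Definition asp_chi (g : asp) : dual C VA := (asp_pair g).2.

Lemma asp_linP (g : asp) : asp_lin g \in Sp. Proof. exact: valP g. Qed.

Lemma aspP (g h : asp) :
  asp_lin g = asp_lin h -> asp_chi g = asp_chi h -> g = h.
Proof.
case: g h => [[T f] hT] [[S f'] hS]; rewrite /asp_lin /asp_chi /= => e1 e2.
by apply: val_inj; rewrite /= e1 e2.
Qed.

Lemma aspM_subproof (g h : asp) : (asp_lin g * asp_lin h)%g \in Sp.
Proof. by rewrite groupM ?asp_linP. Qed.
Lemma aspV_subproof (g : asp) : (asp_lin g)^-1%g \in Sp.
Proof. by rewrite groupV asp_linP. Qed.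

Definition asp_one := @ASp (1%g, 0) (group1 Sp_group).
Definition asp_mul (g h : asp) :=
  @ASp ((asp_lin g * asp_lin h)%g, dual_comp (asp_chi g) (asp_lin h) + asp_chi h)
       (aspM_subproof g h).
Definition asp_inv (g : asp) :=
  @ASp ((asp_lin g)^-1%g, - dual_comp (asp_chi g) (asp_lin g)^-1%g)
       (aspV_subproof g).

Lemma asp_mulA : associative asp_mul.
Proof.
move=> g h k; apply: aspP; rewrite /asp_lin /asp_chi /= ?mulgA //.
by apply/dualP => x; rewrite !(dualDE, dual_compE, zautME) mulrA.
Qed.
Lemma asp_mul1 : left_id asp_one asp_mul.
Proof.
move=> g; apply: aspP; rewrite /asp_lin /asp_chi /= ?mul1g //.
by apply/dualP => x; rewrite !(dualDE, dual_compE) dual0E mul1r.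
Qed.
Lemma asp_mulV : left_inverse asp_one asp_inv asp_mul.
Proof.
move=> g; apply: aspP; rewrite /asp_lin /asp_chi /= ?mulVg //.
apply/dualP => x; rewrite !(dualDE, dual_compE, dualNE, dual0E) zautK.
by rewrite mulVf ?dual_neq0.
Qed.
HB.instance Definition _ :=
  Finite_isGroup.Build asp asp_mulA asp_mul1 asp_mulV.

Definition is_clifford : pred (zaut VA * {ffun VA -> C}) :=
  [pred p : zaut VA * {ffun VA -> C} | [forall u, `|p.2 u| == 1] &&
    [forall u, forall v, p.2 (u + v) * (p.2 u)^-1 * (p.2 v)^-1
                         == beta (p.1 u) (p.1 v) * (beta u v)^-1]].

Record clifford := Clifford {
  cl_pair : zaut VA * {ffun VA -> C}; _ : is_clifford cl_pair }.
HB.instance Definition _ := [isSub for cl_pair].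
HB.instance Definition _ := [Choice of clifford by <:].

Definition cl_lin (g : clifford) : zaut VA := (cl_pair g).1.
Definition cl_fun (g : clifford) : {ffun VA -> C} := (cl_pair g).2.

Lemma cl_norm g u : `|cl_fun g u| = 1.
Proof. by have /andP[/forallP h _] := valP g; apply/eqP/h. Qed.
Lemma cl_neq0 g u : cl_fun g u != 0.
Proof. exact/normC_neq0/cl_norm. Qed.
Lemma clD g u v : cl_fun g (u + v) =
  beta (cl_lin g u) (cl_lin g v) * (beta u v)^-1 * (cl_fun g u * cl_fun g v).
Proof.
have: cl_fun g (u + v) * (cl_fun g u)^-1 * (cl_fun g v)^-1 =
      beta (cl_lin g u) (cl_lin g v) * (beta u v)^-1.
  by have /andP[_ /forallP/(_ u)/forallP h] := valP g; apply/eqP/h.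
by move=> <-; field; rewrite !cl_neq0.
Qed.
Lemma cliffordP (g h : clifford) :
  cl_lin g = cl_lin h -> cl_fun g =1 cl_fun h -> g = h.
Proof.
case: g h => [[T f] hT] [[S f'] hS]; rewrite /cl_lin /cl_fun /= => e1 e2.
by apply: val_inj; congr (_, _); [exact: e1 | exact/ffunP].
Qed.

Lemma cl0 g : cl_fun g 0 = 1.
Proof.
have := clD g 0 0; rewrite addr0 zaut0 !beta0l invr1 !mul1r => e.
by apply: (mulfI (cl_neq0 g 0)); rewrite mulr1 -e.
Qed.

Lemma is_cliffordP (p : zaut VA * {ffun VA -> C}) :
  (forall u, `|p.2 u| = 1) ->
  (forall u v, p.2 (u + v) =
     beta (p.1 u) (p.1 v) * (beta u v)^-1 * (p.2 u * p.2 v)) -> is_clifford p.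
Proof.
move=> h1 h2; apply/andP; split; apply/forallP => u; first by apply/eqP/h1.
have n0 w : p.2 w != 0 by exact: normC_neq0.
apply/forallP => v; rewrite h2; apply/eqP.
by field; rewrite !n0 beta_neq0.
Qed.

Let N := (#|VA| * #|VA|)%N.
Lemma cl_unity g u : cl_fun g u ^+ N = 1.
Proof.
have bn (x y : VA) : (beta x y) ^+ #|VA| = 1.
  by rewrite -betaMnl mulrn_card beta0l.
have claim k :
    exists2 z, z ^+ #|VA| = 1 & cl_fun g (u *+ k) = z * cl_fun g u ^+ k.
  elim: k => [|k [z zn IH]].
    by exists 1; rewrite ?expr1n ?mulr0n ?cl0 ?mulr1.
  rewrite mulrS clD IH exprS.
  exists (beta (cl_lin g u) (cl_lin g (u *+ k)) * (beta u (u *+ k))^-1 * z).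
    by rewrite !exprMn exprVn !bn zn invr1 !mulr1.
  by rewrite -!mulrA; congr (_ * (_ * _)); rewrite mulrCA.
have [z zn] := claim #|VA|; rewrite mulrn_card cl0 /N exprM => e.
have z0 : z != 0.
  apply/eqP => z0; move: zn.
  rewrite z0 expr0n -[_ == _]negbK -lt0n card_zmod_gt0 => /eqP.
  by rewrite eq_sym oner_eq0.
have -> : cl_fun g u ^+ #|VA| = z^-1.
  by apply: (mulfI z0); rewrite -e divff.
by rewrite exprVn zn invr1.
Qed.

Let enc (g : clifford) := (cl_lin g, unity_enc N (cl_fun g)).
Let dec p : option clifford := insub (p.1, @unity_dec C VA N p.2).
Lemma clifford_encK : pcancel enc dec.
Proof.
move=> g; rewrite /dec /enc /= unity_encK ?muln_gt0 ?card_zmod_gt0 //.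
  by rewrite -surjective_pairing; exact: valK.
exact: cl_unity.
Qed.
HB.instance Definition _ := PCanIsCountable clifford_encK.
HB.instance Definition _ : isFinite clifford := PCanIsFinite clifford_encK.

Lemma cl1_subproof : is_clifford (1%g, [ffun=> 1]).
Proof.
apply: is_cliffordP => [u|u v] /=; rewrite !ffunE ?normr1 // !zaut1E.
by rewrite divff ?beta_neq0 ?mulr1.
Qed.
Lemma clM_subproof (g h : clifford) : is_clifford
  ((cl_lin g * cl_lin h)%g,
   [ffun u => cl_fun g (cl_lin h u) * cl_fun h u]).
Proof.
apply: is_cliffordP => [u|u v] /=; rewrite !ffunE.
  by rewrite normrM !cl_norm mulr1.
rewrite zautD !clD !zautME.
set a := beta _ _; set b := beta (cl_lin h u) _; set c := beta u v.
have b0 : b != 0 by exact: beta_neq0.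
have c0 : c != 0 by exact: beta_neq0.
by field; rewrite b0 c0.
Qed.
Lemma clV_subproof (g : clifford) : is_clifford
  ((cl_lin g)^-1%g, [ffun u => (cl_fun g ((cl_lin g)^-1%g u))^-1]).
Proof.
apply: is_cliffordP => [u|u v] /=; rewrite !ffunE.
  by rewrite normfV !cl_norm invr1.
rewrite (@zautD _ (cl_lin g)^-1%g) clD !zautKV.
by field; rewrite !beta_neq0 !cl_neq0.
Qed.

Definition cl_one := Clifford cl1_subproof.
Definition cl_mul g h := Clifford (clM_subproof g h).
Definition cl_inv g := Clifford (clV_subproof g).

Lemma cl_mulA : associative cl_mul.
Proof.
move=> g h k; apply: cliffordP; rewrite /cl_lin /cl_fun /= ?mulgA //.
by move=> x; rewrite !ffunE zautME mulrA.
Qed.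
Lemma cl_mul1 : left_id cl_one cl_mul.
Proof.
move=> g; apply: cliffordP; rewrite /cl_lin /cl_fun /= ?mul1g //.
by move=> x; rewrite !ffunE mul1r.
Qed.
Lemma cl_mulV : left_inverse cl_one cl_inv cl_mul.
Proof.
move=> g; apply: cliffordP; rewrite /cl_lin /cl_fun /= ?mulVg //.
by move=> x; rewrite !ffunE zautK mulVf ?cl_neq0.
Qed.
HB.instance Definition _ :=
  Finite_isGroup.Build clifford cl_mulA cl_mul1 cl_mulV.

Lemma cl_lin_Sp (g : clifford) : cl_lin g \in Sp.
Proof.
apply/SpP => u v; have := clD g u v; rewrite addrC clD.
rewrite [cl_fun g v * _]mulrC.
have n0 : cl_fun g u * cl_fun g v != 0 by rewrite mulf_neq0 ?cl_neq0.
move/(mulIf n0); rewrite /omega.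
have := beta_neq0 (cl_lin g u) (cl_lin g v); have := beta_neq0 u v.
have := beta_neq0 (cl_lin g v) (cl_lin g u); have := beta_neq0 v u.
move: (beta _ _) (beta _ _) (beta _ _) (beta _ _) => d c b a d0 c0 b0 a0 e.
apply/eqP; rewrite eqr_div //; move/eqP: e; rewrite eqr_div // => /eqP <-.
by rewrite mulrC.
Qed.

End Groups.

Section InducedRepresentation.
Variables (F : fieldType) (gT : finGroupType) (H : {group gT}) (n : nat).
Variable s : mx_representation F H n.

Definition rep_char (G : {set gT}) m (rG : mx_representation F G m) (x : gT) : F :=
  \tr (rG x) *+ (x \in G).

Definition coset_count := #|lcosets H [set: gT]|.
Definition coset_rep (i : 'I_coset_count) : gT := repr (enum_val i).

Definition ext0_mx (x : gT) : 'M[F]_n := if x \in H then s x else 0.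

(* Ind_H^gT s in block form, relative to the left transversal coset_rep: the  *)
(* j-th block of coordinates is the translate t_j (x) F^n, and x t_j lies in  *)
(* t_i H for exactly one i.                                                   *)
Definition ind_degree := (\sum_(i < coset_count) n)%N.
Definition ind_mx (x : gT) : 'M[F]_ind_degree :=
  \mxblock_(i < coset_count, j < coset_count)
     ext0_mx ((coset_rep i)^-1 * x * coset_rep j)%g.

Lemma coset_rep_ex x : exists i, ((coset_rep i)^-1 * x)%g \in H.
Proof.
have xH : (x *: H)%g \in lcosets H [set: gT].
  by apply/lcosetsP; exists x; rewrite ?inE.
exists (enum_rank_in xH (x *: H)%g); rewrite /coset_rep enum_rankK_in //.
rewrite -mem_lcoset lcoset_sym; apply: (mem_repr x); exact: lcoset_refl.
Qed.

Lemma coset_rep_inj x i j : ((coset_rep i)^-1 * x)%g \in H ->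
  ((coset_rep j)^-1 * x)%g \in H -> i = j.
Proof.
have repE k : enum_val k = (coset_rep k *: H)%g.
  have /lcosetsP[y _ e] := enum_valP k; rewrite e.
  have : coset_rep k \in (y *: H)%g.
    by rewrite /coset_rep e; apply: (mem_repr y); exact: lcoset_refl.
  by move/lcoset_eqP.
rewrite -!mem_lcoset => /lcoset_eqP ei /lcoset_eqP ej.
by apply: enum_val_inj; rewrite !repE -ei -ej.
Qed.

Lemma ind_mx_repr : mx_repr [set: gT] ind_mx.
Proof.
split=> [|x y _ _]; rewrite /ind_mx.
  rewrite -mxdiagZ /mxdiag; apply: eq_mxblock => i j; rewrite mulg1 /ext0_mx.
  case: eqVneq => [->|ne]; first by rewrite mulVg group1 repr_mx1 conform_mx_id.
  case: ifP => // h; case/eqP: ne; apply: (coset_rep_inj h).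
  by rewrite mulVg group1.
rewrite mul_mxblock; apply: eq_mxblock => i j.
have [k hk] := coset_rep_ex (y * coset_rep j)%g; rewrite mulgA in hk.
rewrite (bigD1 k) //= big1 ?addr0 => [|l lk]; last first.
  rewrite [X in _ *m X]/ext0_mx; case: ifP => [hl|]; last by rewrite mulmx0.
  case/eqP: lk; rewrite -mulgA in hl; rewrite -mulgA in hk.
  exact: (coset_rep_inj hl hk).
have -> : ((coset_rep i)^-1 * (x * y) * coset_rep j =
  ((coset_rep i)^-1 * x * coset_rep k) * ((coset_rep k)^-1 * y * coset_rep j))%g.
  by rewrite !mulgA mulgK.
rewrite /ext0_mx hk groupMr //; case: ifP => h; last by rewrite mul0mx.
by rewrite repr_mxM.
Qed.

Definition ind_repr := MxRepresentation ind_mx_repr.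
End InducedRepresentation.

Section Functor.
Variables (C : numClosedFieldType) (A : finZmodType) (n : nat).
Variable pi : mx_representation C [set: asp C A] n.

Definition asp_translation (f : dual C (VA C A)) : asp C A :=
  @ASp C A (1%g, f) (group1 (Sp_group C A)).

Definition asp_of_cl (g : clifford C A) : asp C A :=
  @ASp C A (cl_lin g, 0) (cl_lin_Sp g).

(* xi belongs to U_v; vectors are columns, acted upon on the left.            *)
Definition in_weight (v : VA C A) (xi : 'cV[C]_n) : Prop :=
  forall f, pi (asp_translation f) *m xi = f v *: xi.

(* The averaging projector onto U_v (weight_projP, weight_proj_id), with the  *)
(* other weight spaces in its kernel (weight_proj_0).                         *)
Definition weight_proj (v : VA C A) : 'M[C]_n :=
  #|{: dual C (VA C A)}|%:R^-1 *:
    \sum_(f : dual C (VA C A)) (f v)^-1 *: pi (asp_translation f).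

(* On U_v this is lambda(v) rho(T), see F_mx_weight; as the U_v span          *)
(* (sum_weight_proj), that property determines F_mx g.                        *)
Definition F_mx (g : clifford C A) : 'M[C]_n :=
  pi (asp_of_cl g) *m \sum_(v : VA C A) cl_fun g v *: weight_proj v.

Lemma asp_translationD f f' :
  asp_translation (f + f') = (asp_translation f * asp_translation f')%g.
Proof.
apply: aspP; rewrite /asp_lin /asp_chi /= ?mulg1 //.
by apply/dualP => x; rewrite !dualDE dual_compE zaut1E.
Qed.

Lemma asp_of_cl_translation g f :
  (asp_translation f * asp_of_cl g =
   asp_of_cl g * asp_translation (dual_comp f (cl_lin g)))%g.
Proof.
apply: aspP; rewrite /asp_lin /asp_chi /= ?mulg1 ?mul1g //.
by apply/dualP => x; rewrite !dualDE !dual_compE !dual0E mulr1 mul1r.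
Qed.

Lemma asp_of_clM g h : asp_of_cl (g * h)%g = (asp_of_cl g * asp_of_cl h)%g.
Proof.
apply: aspP; rewrite /asp_lin /asp_chi //=.
by apply/dualP => x; rewrite !dualDE dual_compE !dual0E mulr1.
Qed.

Lemma pi_transD f f' : pi (asp_translation (f + f')) =
  pi (asp_translation f) *m pi (asp_translation f').
Proof. by rewrite asp_translationD repr_mxM ?inE. Qed.

Let cardN0 : #|{: dual C (VA C A)}|%:R != 0 :> C.
Proof. by rewrite pnatr_eq0 -lt0n card_zmod_gt0. Qed.

Lemma weight_proj_id v xi : in_weight v xi -> weight_proj v *m xi = xi.
Proof.
move=> h; rewrite /weight_proj -scalemxAl mulmx_suml.
under eq_bigr do rewrite -scalemxAl h scalerA mulVf ?dual_neq0 // scale1r.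
by rewrite sumr_const -scaler_nat scalerA mulVf // scale1r.
Qed.

Lemma weight_proj_0 v w xi :
  in_weight v xi -> w != v -> weight_proj w *m xi = 0.
Proof.
move=> h vw; rewrite /weight_proj -scalemxAl mulmx_suml.
under eq_bigr do rewrite -scalemxAl h scalerA -dualN -dualD.
by rewrite -scaler_suml sum_dual ?scale0r ?scaler0 // addrC subr_eq0 eq_sym.
Qed.

Lemma weight_projP v (xi : 'cV[C]_n) : in_weight v (weight_proj v *m xi).
Proof.
move=> f; rewrite /weight_proj -!scalemxAl -scalemxAr scalerA mulrC -scalerA.
congr (_ *: _); rewrite mulmxA scalemxAl; congr (_ *m _).
rewrite mulmx_sumr [in RHS](reindex_inj (addrI f)) /= scaler_sumr.
apply: eq_bigr => f' _; rewrite -scalemxAr pi_transD scalerA; congr (_ *: _).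
by rewrite dualDE invfM mulrA divff ?dual_neq0 // mul1r.
Qed.

Lemma sum_weight_proj : \sum_v weight_proj v = 1%:M.
Proof.
rewrite /weight_proj -scaler_sumr exchange_big /= (bigD1 0) //=.
rewrite [X in _ + X]big1 ?addr0 => [|f f0]; last first.
  rewrite -scaler_suml.
  under eq_bigr do rewrite -dualNE.
  by rewrite sum_dual_B ?scale0r // oppr_eq0.
rewrite -scaler_suml; under eq_bigr do rewrite dual0E invr1.
rewrite sumr_const -(card_dual C (VA C A)) scalerA mulVf // scale1r.
have -> : asp_translation 0 = 1%g by exact: val_inj.
exact: repr_mx1.
Qed.

Lemma F_mx_weight g v xi : in_weight v xi ->
  F_mx g *m xi = cl_fun g v *: (pi (asp_of_cl g) *m xi).
Proof.
move=> h; rewrite /F_mx -mulmxA mulmx_suml (bigD1 v) //= big1 ?addr0.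
  by rewrite -scalemxAl weight_proj_id // -scalemxAr.
by move=> w wv; rewrite -scalemxAl (weight_proj_0 h wv) scaler0.
Qed.

Lemma in_weight_lin g v xi :
  in_weight v xi -> in_weight (cl_lin g v) (pi (asp_of_cl g) *m xi).
Proof.
move=> h f; rewrite mulmxA -repr_mxM ?inE // asp_of_cl_translation.
by rewrite repr_mxM ?inE // -mulmxA h -scalemxAr dual_compE.
Qed.

Lemma in_weightZ v a xi : in_weight v xi -> in_weight v (a *: xi).
Proof. by move=> h f; rewrite -scalemxAr h !scalerA mulrC. Qed.

Lemma weight_ext (M N : 'M[C]_n) :
  (forall v xi, in_weight v xi -> M *m xi = N *m xi) -> M = N.
Proof.
move=> h; rewrite -[M]mulmx1 -[N]mulmx1 -sum_weight_proj !mulmx_sumr.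
apply: eq_bigr => v _; apply/matrixP => i j.
have: col j (M *m weight_proj v) = col j (N *m weight_proj v).
  by rewrite !colE -!mulmxA; apply: h; exact: weight_projP.
by move/matrixP/(_ i 0); rewrite ![col _ _ _ _]mxE.
Qed.

Lemma F_mx_repr : mx_repr [set: clifford C A] F_mx.
Proof.
split=> [|g h _ _]; apply: weight_ext => v xi hv; rewrite ?mul1mx.
  rewrite (F_mx_weight _ hv) [cl_fun _ _]ffunE scale1r.
  have -> : asp_of_cl 1%g = 1%g by exact: val_inj.
  by rewrite repr_mx1 mul1mx.
rewrite -[RHS]mulmxA !(F_mx_weight _ hv) -scalemxAr.
rewrite (F_mx_weight _ (in_weight_lin h hv)) asp_of_clM repr_mxM ?inE //.
by rewrite scalerA -mulmxA mulrC; congr (_ *: _); exact: ffunE.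
Qed.

Definition F_repr := MxRepresentation F_mx_repr.
End Functor.

Section Tables.
Variables (C : numClosedFieldType) (A : finZmodType).

Definition ASpStab (u : VA C A) : {set asp C A} :=
  [set g : asp C A | asp_lin g \in SpStab u].

Lemma mem_ASpStab u g : (g \in ASpStab u) = (asp_lin g \in SpStab u).
Proof. by rewrite in_set. Qed.

Lemma ASpStab_group_set u : group_set (ASpStab u).
Proof.
apply/group_setP; split=> [|g h]; first by rewrite mem_ASpStab group1.
by rewrite !mem_ASpStab => hg hh; exact: (groupM (G := SpStab_group u) hg hh).
Qed.
Canonical ASpStab_group u := Group (ASpStab_group_set u).

Section Row.
Variables (u : VA C A) (n : nat) (s : mx_representation C (SpStab u) n).

Definition tilde_mx (g : asp C A) : 'M[C]_n := asp_chi g u *: s (asp_lin g).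

Lemma tilde_mx_repr : mx_repr (ASpStab u) tilde_mx.
Proof.
split=> [|g h]; rewrite /tilde_mx.
  by rewrite [asp_chi _ _]dual0E scale1r (@repr_mx1 _ _ (SpStab_group u)).
rewrite !mem_ASpStab => hg hh; have /setIdP[_ /eqP hu] := hh.
rewrite -scalemxAl -scalemxAr scalerA -(repr_mxM (G := SpStab_group u) s hg hh).
by congr (_ *: _); rewrite [LHS]dualDE dual_compE hu.
Qed.
Definition tilde_repr := MxRepresentation tilde_mx_repr.

Definition row_degree : nat := ind_degree (ASpStab_group u) n.

Definition Pi_ASp : mx_representation C [set: asp C A] row_degree :=
  ind_repr (H := ASpStab_group u) tilde_repr.

Definition Pi_Cl : mx_representation C [set: clifford C A] row_degree :=
  F_repr Pi_ASp.
End Row.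

(* P induces a bijection from the disjoint union over u in us of the sets     *)
(* Irr(Sp(V_A)_u) to the irreducible characters of gT. Elements of Irr are    *)
(* given by irreducible representations up to equality of characters.         *)
Definition row_parametrization (us : {set VA C A}) (gT : finGroupType)
    (P : forall u n, mx_representation C (SpStab u) n ->
           mx_representation C [set: gT] (row_degree u n)) : Prop :=
  [/\ forall u n (s : mx_representation C (SpStab_group u) n),
        u \in us -> mx_irreducible s ->
        mx_irreducible (G := [set: gT]%G) (P u n s),
      forall u n (s : mx_representation C (SpStab_group u) n)
             u' n' (s' : mx_representation C (SpStab_group u') n'),
        u \in us -> mx_irreducible s -> u' \in us -> mx_irreducible s' ->
        rep_char (P u n s) =1 rep_char (P u' n' s') <->
        u = u' /\ rep_char s =1 rep_char s'
    & forall m (t : mx_representation C [set: gT]%G m), mx_irreducible t ->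
        exists u n (s : mx_representation C (SpStab_group u) n),
          [/\ u \in us, mx_irreducible s & rep_char t =1 rep_char (P u n s)]].

Definition column := {T : zaut (VA C A) & dual C (fixV T)}.

(* S . l = l \o S^-1. As in fix_act, the default of insubd is not taken when  *)
(* S centralizes T, see dual_actE.                                            *)
Definition dual_act (T S : zaut (VA C A)) (l : dual C (fixV T)) :
  dual C (fixV T) := insubd l [ffun x => l (fix_act S^-1%g x)].

Lemma dual_actE T S (l : dual C (fixV T)) x : S \in 'C[T]%g ->
  dual_act S l x = l (fix_act S^-1%g x).
Proof.
move=> cS; have cV : S^-1%g \in 'C[T]%g by rewrite groupV.
rewrite /dual_act -[dual_fun _]/(val _) val_insubd ifT ?ffunE //.
apply/andP; split; apply/forallP => y; first by rewrite ffunE dual_norm.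
apply/forallP => z; rewrite !ffunE -dualD; apply/eqP; congr (l _).
by apply: val_inj; rewrite raddfD /= !fix_actE // raddfD zautD.
Qed.

Definition column_orbit (c : column) : {set column} :=
  [set Tagged (fun T => dual C (fixV T)) (dual_act S (tagged c))
     | S in 'C_(Sp C A)[tag c]%g].

Definition asp_column (c : column) : {set asp C A} :=
  [set g : asp C A | (asp_lin g == tag c) &&
     [forall x : fixV (tag c), asp_chi g (val x) == tagged c x]].

Definition cl_column (c : column) : {set clifford C A} :=
  [set g : clifford C A | (cl_lin g == tag c) &&
     [forall x : fixV (tag c), cl_fun g (val x) == tagged c x]].

(* lab c is the set of the elements (T, lambda) that restrict to the column   *)
(* label c = (T, l); class_support (lab c) [set: gT] is the union of their    *)
(* conjugacy classes. The first clause states that it is a single class.      *)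
Definition column_parametrization (ts : {set zaut (VA C A)})
    (gT : finGroupType) (lab : column -> {set gT}) : Prop :=
  [/\ forall c, tag c \in ts ->
        class_support (lab c) [set: gT] \in classes [set: gT],
      forall c c', tag c \in ts -> tag c' \in ts ->
        class_support (lab c) [set: gT] = class_support (lab c') [set: gT] <->
        column_orbit c = column_orbit c'
    & forall K, K \in classes [set: gT] ->
        exists2 c, tag c \in ts & K = class_support (lab c) [set: gT]].

End Tables.

(* Main.v *)
Require Import Defs.
From mathcomp Require Import all_boot all_order all_algebra all_fingroup.
From mathcomp Require Import all_solvable all_field all_character.
From mathcomp Require Import reals complex spectral ring.

Set Implicit Arguments.
Unset Strict Implicit.
Unset Printing Implicit Defensive.

Import Order.TTheory GRing.Theory Num.Theory.
Local Open Scope ring_scope.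

(** Why the two tables agree.  Write V for V_A.  Both groups consist of pairs
    (T, lambda) with T in Sp(V) and lambda : V -> U(1), multiplied by
    (T, lambda)(S, mu) = (TS, lambda^S mu); they differ only in the defect
    lambda(u + v) / (lambda(u) lambda(v)), which is prescribed by T.  In
    ASp(A) it is 1, in C(A) it is beta(Tu, Tv) / beta(u, v), and in both
    cases it is 1 as soon as T fixes u and v, so that lambda restricts to a
    character of F_T.  The record [sp_extension] keeps exactly this common
    structure, and both tables are computed from it.

    Columns ([columns_parametrized]).  Two elements over the same T differ by
    a character r of V.  Conjugation by the translation by f multiplies lambda
    by v |-> f(v - Tv).  A character of V has this form as soon as it is
    trivial on ker(1 - T) = F_T ([dual_factor]), so the elements over T that
    have the same restriction l to F_T are conjugate; conjugation by the
    elements over the centralizer of T then acts on l as in the statement.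

    Rows ([rows_parametrized]).  In a representation M of either group the
    translations form a copy of the dual of V, and M splits into weight spaces
    indexed by V which the group permutes through T.  If the weights of M form
    the orbit of u, the elements over the stabilizer of u act on the weight
    space of u by lambda(u) times a representation s of Sp(V)_u: this is
    [carries].  The method of little groups works for that relation alone:
    every irreducible M carries some s, irreducibility passes between M and s
    in both directions, and the character of s can be read off that of M by
    Fourier inversion over the translations.

    Values ([carries_column_char]).  In the trace of M(T, lambda) only the
    weight spaces of the fixed vectors x = T_x u of T contribute, each by
    lambda(x) times the trace of s(T_x^-1 T T_x); and lambda(x) = l(x).

    It remains to see that Pi(u, s) carries s ([Pi_ASp_carries]), that the
    functor from representations of ASp(A) to those of C(A) preserves this
    relation, since it leaves the weight spaces unchanged
    ([F_repr_carries]), and that C(A) maps onto Sp(V) ([cl_lin_onto]): the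
    defect attached to T is a symmetric 2-cocycle, hence a coboundary
    ([symmetric_cocycle_coboundary]). *)

(** * Characters and cocycles of finite abelian groups *)

Section Characters.
Variable C : numClosedFieldType.

Section Factor.
Variables (B B' : finZmodType) (phi : B -> B').
Hypothesis phiD : {morph phi : x y / x + y}.

Lemma dual_pullback_subproof (chi : dual C B') :
  is_dual [ffun x => chi (phi x)].
Proof.
apply/andP; split; apply/forallP => x; first by rewrite ffunE dual_norm.
by apply/forallP => y; rewrite !ffunE phiD dualD.
Qed.
Definition dual_pullback chi := Dual (dual_pullback_subproof chi).

Lemma dual_pullbackE chi x : dual_pullback chi x = chi (phi x).
Proof. exact: ffunE. Qed.

(** U(1) is divisible, so a character of the image of phi extends to B'.  The
    proof is by orthogonality: if mu were different from every chi o phi, then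
    the sum of chi(phi x) / mu(x) over all chi and x would vanish; summed over
    chi first, it is |ker phi| |B'|, which is not 0. *)
Lemma dual_factor (mu : dual C B) : (forall x, phi x = 0 -> mu x = 1) ->
  exists chi : dual C B', forall x, chi (phi x) = mu x.
Proof.
move=> mu1; have [/existsP[chi /eqP chiP]|] :=
  boolP [exists chi, dual_pullback chi == mu].
  by exists chi => x; rewrite -chiP dual_pullbackE.
rewrite negb_exists => /forallP no.
pose S : C :=
  \sum_(chi : dual C B') \sum_x (dual_pullback chi - mu : dual C B) x.
have S0 : S = 0.
  by apply: big1 => chi _; apply: sum_dual_B; rewrite subr_eq0 no.
have : S = (#|[pred x | phi x == 0]| * #|B'|)%:R.
  rewrite /S exchange_big natrM -sumr_const mulr_suml.
  rewrite [RHS]big_mkcond; apply: eq_bigr => x _.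
  under eq_bigr do rewrite dualDE dualNE dual_pullbackE.
  rewrite -mulr_suml inE; case: eqVneq => [x0|/(sum_dual C) ->].
    rewrite x0 mu1 // invr1 mulr1 mul1r.
    by under eq_bigr do rewrite dual0; rewrite sumr_const card_dual.
  by rewrite mul0r.
have phi0 : phi 0 = 0 by apply: (addrI (phi 0)); rewrite -phiD !addr0.
rewrite S0 => /esym/eqP; rewrite pnatr_eq0 muln_eq0 -[X in _ || X]negbK.
rewrite -lt0n card_zmod_gt0 orbF => /eqP/card0_eq/(_ 0).
by rewrite inE phi0 eqxx.
Qed.
End Factor.

Section Cocycle.
Variables (B : finZmodType) (c : B -> B -> C).
Hypotheses (c_norm : forall x y, `|c x y| = 1) (cC : forall x y, c x y = c y x).
Hypothesis c_cocycle : forall x y z,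
  c x y * c (x + y) z = c y z * c x (y + z).

(** Translation by x on the row vectors C[B], twisted by c: the basis vector b
    goes to c(x, b) (x + b). *)
Let twisted_shift (x : B) : 'M[C]_#|B| :=
  \matrix_(i, j) (c x (enum_val i) *+ (enum_val j == x + enum_val i)).

Let twisted_shiftM x y :
  twisted_shift x *m twisted_shift y = c x y *: twisted_shift (x + y).
Proof.
apply/matrixP => i j; rewrite !mxE (bigD1 (enum_rank (x + enum_val i))) //=.
rewrite big1 ?addr0 => [|k ki]; last first.
  rewrite !mxE [enum_val k == _](_ : _ = false) ?mulr0n ?mul0r //.
  by apply: contraNF ki => /eqP <-; rewrite enum_valK.
rewrite !mxE !enum_rankK eqxx mulr1n mulrnAr addrA [y + x]addrC [RHS]mulrnAr.
by congr (_ *+ _); rewrite [c x y]cC [x + y]addrC c_cocycle.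
Qed.

(** Since c is symmetric, the twisted translations commute, so they have a
    common eigenvector; the inverses of its eigenvalues trivialize c. *)
Lemma symmetric_cocycle_coboundary : exists2 lam : {ffun B -> C},
  forall x, `|lam x| = 1
  & forall x y, lam (x + y) = c x y * (lam x * lam y).
Proof.
have cN0 x y : c x y != 0 by apply: normC_neq0.
have [|v v0 /allP vP] := common_eigenvector (card_zmod_gt0 B)
    (As := [seq twisted_shift x | x <- enum B]).
  move=> _ _ /mapP[x _ ->] /mapP[y _ ->].
  by rewrite /comm_mx !twisted_shiftM cC addrC.
have act x : {a | v *m twisted_shift x = a *: v}.
  by apply: sig_eqW; apply/sub_rVP/vP/map_f; rewrite mem_enum.
pose m x := sval (act x).
have mE x : v *m twisted_shift x = m x *: v by exact: svalP (act x).
have vI (s t : C) : s *: v = t *: v -> s = t.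
  move/eqP; rewrite -subr_eq0 -scalerBl scaler_eq0 (negbTE v0) orbF subr_eq0.
  by move/eqP.
have mM x y : m x * m y = c x y * m (x + y).
  apply: vI; transitivity (v *m (twisted_shift x *m twisted_shift y)).
    by rewrite mulmxA mE -scalemxAl mE scalerA.
  by rewrite twisted_shiftM -scalemxAr mE scalerA.
have m0 : m 0 != 0.
  rewrite (_ : m 0 = c 0 0) ?cN0 //; apply: vI; rewrite -mE.
  rewrite (_ : twisted_shift 0 = (c 0 0)%:M) ?mul_mx_scalar //.
  apply/matrixP => i j; rewrite !mxE add0r eq_sym (inj_eq enum_val_inj).
  congr (_ *+ _); have := c_cocycle 0 0 (enum_val i).
  by rewrite !add0r => /(mulIf (cN0 _ _)).
have mN0 x : m x != 0.
  apply: contraTneq (mulf_neq0 (cN0 x (- x)) m0) => mx0.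
  by rewrite -[in m 0](subrr x) -mM mx0 mul0r eqxx.
pose lam := [ffun x => (m x)^-1].
have lamD x y : lam (x + y) = c x y * (lam x * lam y).
  rewrite !ffunE; apply: (mulIf (mN0 (x + y))); rewrite mulVf //.
  by rewrite -invfM mulrAC -mM mulfV ?mulf_neq0.
(* The function |lam| is a homomorphism from a finite group to the positive
   reals. *)
exists lam => // x; have nD y z : `|lam (y + z)| = `|lam y| * `|lam z|.
  by rewrite lamD !normrM c_norm mul1r.
have lN0 : `|lam 0| != 0 by rewrite normr_eq0 ffunE invr_eq0.
have n0 : `|lam 0| = 1.
  by apply: (mulfI lN0); rewrite -nD addr0 mulr1.
have nMn k : `|lam (x *+ k)| = `|lam x| ^+ k.
  by elim: k => [|k IH]; rewrite ?mulr0n // mulrS nD IH exprS.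
apply/eqP; rewrite -(pexpr_eq1 (card_zmod_gt0 B)) ?normr_ge0 //.
by rewrite -nMn mulrn_card n0.
Qed.
End Cocycle.
End Characters.

(** * Columns: conjugacy classes of extensions of the symplectic group *)

Section Transversals.
Variables (T : finType) (X : {set T}) (P : {set {set T}}) (D : {set T}).
Hypothesis trX : is_transversal X P D.

Lemma transversal_meets (B : {set T}) : B \in P -> exists2 x, x \in X & x \in B.
Proof.
case/and3P: trX => _ _ /forall_inP h /h/cards1P[x eX].
by exists x; have /setIP[] : x \in X :&: B by rewrite eX set11.
Qed.

Lemma transversal_inj (B : {set T}) x y : B \in P ->
  x \in X -> y \in X -> x \in B -> y \in B -> x = y.
Proof.
case/and3P: trX => _ _ /forall_inP h /h/cards1P[z eX] xX yX xB yB.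
have : x \in X :&: B by rewrite inE xX.
have : y \in X :&: B by rewrite inE yX.
by rewrite eX !inE => /eqP-> /eqP->.
Qed.
End Transversals.

Section Extensions.
Variables (C : numClosedFieldType) (A : finZmodType).
Local Notation V := (VA C A).

Lemma fixVP (T : zaut V) (x : fixV T) : T (val x) = val x.
Proof. by have := valP x; rewrite unfold_in => /eqP. Qed.

Lemma dual_actM (T S S' : zaut V) (l : dual C (fixV T)) :
  S \in 'C[T]%g -> S' \in 'C[T]%g ->
  dual_act (S * S')%g l = dual_act S (dual_act S' l).
Proof.
move=> cS cS'; apply/dualP => x; rewrite !dual_actE ?groupM //.
congr (l _); apply: val_inj; rewrite !fix_actE ?groupV ?groupM //.
by rewrite invMg zautME.
Qed.

Lemma column_orbit_refl (c : column C A) : c \in column_orbit c.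
Proof.
case: c => T l; apply/imsetP; exists 1%g; first by rewrite !group1.
congr existT; apply/dualP => x; rewrite dual_actE ?group1 //.
congr (l _); apply: val_inj.
by rewrite fix_actE ?groupV ?group1 // invg1 zaut1E.
Qed.

Lemma column_orbit_act (T S : zaut V) (l : dual C (fixV T)) :
  S \in 'C_(Sp C A)[T]%g ->
  column_orbit (Tagged (fun T => dual C (fixV T)) (dual_act S l)) =
  column_orbit (Tagged (fun T => dual C (fixV T)) l).
Proof.
move=> cS; apply/setP => c; apply/imsetP/imsetP => -[S' cS' ->] /=.
  exists (S' * S)%g; first exact: (groupM cS' cS).
  have [[_ cS1] [_ cS'1]] := (setIP cS, setIP cS').
  by rewrite dual_actM.
exists (S' * S^-1)%g; first by apply: (groupM cS'); rewrite groupV.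
have [[_ cS1] [_ cS'1]] := (setIP cS, setIP cS').
by rewrite /= -dual_actM ?mulgKV // groupM // groupV.
Qed.

(** The groups of pairs (lin g, mult g) to which both C(A) and ASp(A) belong.
    The defect measures how far mult g is from a character of V; it depends on
    g only through lin g, so two elements over the same T differ by a
    translation. *)
Record sp_extension (gT : finGroupType) := SpExtension {
  lin : gT -> zaut V;
  mult : gT -> V -> C;
  translation : dual C V -> gT;
  defect : zaut V -> V -> V -> C;
  linM : {morph lin : g h / (g * h)%g};
  lin_Sp : forall g, lin g \in Sp C A;
  lin_onto : forall T, T \in Sp C A -> exists g, lin g = T;
  mult_norm : forall g v, `|mult g v| = 1;
  multM : forall g h v, mult (g * h)%g v = mult g (lin h v) * mult h v;
  multD : forall g u v,
    mult g (u + v) = defect (lin g) u v * (mult g u * mult g v);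
  defect_fixed : forall (T : zaut V) u v, T u = u -> T v = v ->
    defect T u v = 1;
  lin_translation : forall f, lin (translation f) = 1%g;
  mult_translation : forall f, mult (translation f) =1 f;
  ext_inj : forall g h, lin g = lin h -> mult g =1 mult h -> g = h }.

Section Theory.
Variables (gT : finGroupType) (E : sp_extension gT).
Local Notation lin := (lin E).
Local Notation mult := (mult E).
Local Notation trans := (translation E).
Local Notation "[ 'G' ]" := [set: gT].

Lemma mult_neq0 g v : mult g v != 0.
Proof. exact/normC_neq0/mult_norm. Qed.

Lemma lin1 : lin 1%g = 1%g.
Proof. by apply: (mulgI (lin 1%g)); rewrite -linM !mulg1. Qed.

Lemma linV g : lin g^-1%g = (lin g)^-1%g.
Proof. by apply: (mulgI (lin g)); rewrite -linM !mulgV lin1. Qed.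

Lemma linJ g k : lin (g ^ k)%g = (lin g ^ lin k)%g.
Proof. by rewrite !conjgE !linM linV. Qed.

Lemma mult1 v : mult 1%g v = 1.
Proof.
apply: (mulfI (mult_neq0 1%g v)); rewrite mulr1.
by rewrite -[in RHS](mulg1 1%g) multM lin1 zaut1E.
Qed.

Lemma multVl g v : mult g^-1%g (lin g v) * mult g v = 1.
Proof. by rewrite -multM mulVg mult1. Qed.

(** When g fixes the image of v under k, the factors that k and its inverse
    contribute cancel. *)
Lemma multJ g k v : lin g (lin k v) = lin k v ->
  mult (g ^ k)%g v = mult g (lin k v).
Proof.
move=> gkv; rewrite conjgE multM linM zautME gkv multM.
by rewrite mulrCA multVl mulr1.
Qed.

Lemma eq_translation (f : dual C V) g :
  (forall v, mult g v = f v) -> lin g = 1%g -> g = trans f.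
Proof.
move=> fg g1; apply: (@ext_inj _ E) => [|v]; first by rewrite lin_translation.
by rewrite mult_translation.
Qed.

Lemma translation0 : trans 0 = 1%g.
Proof.
by apply/esym/eq_translation => [v|]; rewrite ?dual0E ?mult1 ?lin1.
Qed.

Lemma translationD f f' : trans (f + f') = (trans f * trans f')%g.
Proof.
apply/esym/eq_translation => [v|].
  by rewrite dualDE multM !lin_translation !mult_translation zaut1E.
by rewrite linM !lin_translation mulg1.
Qed.

Lemma mul_translation g f :
  (g * trans (dual_comp f (lin g)) = trans f * g)%g.
Proof.
apply: (@ext_inj _ E) => [|v].
  by rewrite !linM !lin_translation mulg1 mul1g.
rewrite !multM lin_translation.
by rewrite !mult_translation zaut1E dual_compE mulrC.
Qed.

Section Ratio.
Variables (g h : gT).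
Hypothesis gh : lin g = lin h.

Lemma mult_ratio_subproof : is_dual [ffun v => mult h v / mult g v].
Proof.
apply/andP; split; apply/forallP => u.
  by rewrite ffunE normf_div !mult_norm divr1.
apply/forallP => v; rewrite !ffunE !multD gh; apply/eqP.
rewrite -mulf_div divff ?mul1r ?mulf_div //.
have: mult h (u + v) != 0 by exact: mult_neq0.
by rewrite multD mulf_eq0 negb_or => /andP[].
Qed.
Definition mult_ratio := Dual mult_ratio_subproof.

Lemma mult_ratioE v : mult_ratio v = mult h v / mult g v.
Proof. exact: ffunE. Qed.
End Ratio.

(** Conjugating g by the translation by f multiplies mult g by the character
    v |-> f(v - Tv), where T = lin g.  The ratio of mult h to mult g is trivial
    on ker(1 - T), so it is of this form. *)
Lemma translation_conjugate g h : lin g = lin h ->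
  (forall v, lin g v = v -> mult g v = mult h v) ->
  exists f, h = (g ^ trans f)%g.
Proof.
move=> gh fix_gh.
have phiD : {morph (fun v => v - lin g v) : u v / u + v}.
  by move=> u v; rewrite zautD opprD addrACA.
have [|f fE] := dual_factor phiD (mu := mult_ratio gh).
  move=> v /eqP; rewrite subr_eq0 => /eqP/esym gv.
  by rewrite mult_ratioE -fix_gh // divff ?mult_neq0.
exists f; apply: (@ext_inj _ E) => [|v].
  by rewrite linJ lin_translation conjg1.
have -> : mult h v = f (v - lin g v) * mult g v.
  by rewrite fE mult_ratioE mulfVK ?mult_neq0.
rewrite conjgE !multM linM lin_translation mulg1 zaut1E mult_translation.
rewrite dualD dualN.
have := multVl (trans f) (lin g v).
rewrite lin_translation zaut1E mult_translation.
move/(canRL (mulfK (dual_neq0 _ _))) => ->; rewrite div1r.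
by rewrite [RHS]mulrA [RHS]mulrC mulrA.
Qed.

Lemma mult_fix_subproof g : is_dual [ffun x : fixV (lin g) => mult g (val x)].
Proof.
apply/andP; split; apply/forallP => u; first by rewrite ffunE mult_norm.
apply/forallP => v; rewrite !ffunE raddfD /= multD.
by rewrite defect_fixed ?fixVP ?mul1r.
Qed.
Definition mult_fix g := Dual (mult_fix_subproof g).

Lemma mult_fixE g x : mult_fix g x = mult g (val x).
Proof. exact: ffunE. Qed.

Definition ext_column (c : column C A) : {set gT} :=
  [set g | (lin g == tag c) &&
     [forall x : fixV (tag c), mult g (val x) == tagged c x]].

Lemma ext_columnP (T : zaut V) (l : dual C (fixV T)) g :
  reflect (lin g = T /\ forall x : fixV T, mult g (val x) = l x)
          (g \in ext_column (Tagged (fun T => dual C (fixV T)) l)).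
Proof.
rewrite inE; apply: (iffP andP) => -[/eqP gT_ h]; split=> //.
  by move=> x; apply/eqP/(forallP h).
by apply/forallP => x; rewrite h.
Qed.

Lemma mem_mult_fix_column g :
  g \in ext_column (Tagged (fun T => dual C (fixV T)) (mult_fix g)).
Proof. by apply/ext_columnP; split=> // x; rewrite mult_fixE. Qed.

(** Any g0 over T restricts to some character of F_T; the quotient of l by it
    extends from F_T to V, and translating by the extension corrects g0. *)
Lemma ext_column_neq0 T (l : dual C (fixV T)) : T \in Sp C A ->
  exists g, g \in ext_column (Tagged (fun T => dual C (fixV T)) l).
Proof.
case/(lin_onto E) => g0 g0T; move: l; rewrite -{T}g0T => l.
have [|f fE] := dual_factor (raddfD (val : fixV (lin g0) -> V))
                            (mu := l - mult_fix g0).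
  by move=> x x0; rewrite (_ : x = 0) ?dual0 //; apply: val_inj.
exists (g0 * trans f)%g; apply/ext_columnP; split.
  by rewrite linM lin_translation mulg1.
move=> x; rewrite multM lin_translation zaut1E mult_translation fE.
by rewrite dualDE dualNE mult_fixE mulrCA mulfV ?mulr1 ?mult_neq0.
Qed.

Lemma class_support_column T (l : dual C (fixV T)) g :
  g \in ext_column (Tagged (fun T => dual C (fixV T)) l) ->
  class_support (ext_column (Tagged (fun T => dual C (fixV T)) l)) [G] =
  (g ^: [G])%g.
Proof.
move=> gl; apply/eqP; rewrite eqEsubset; apply/andP; split; last first.
  by apply/subsetP => _ /imsetP[k kG ->]; exact: imset2_f.
apply/subsetP => _ /imset2P[h k hl _ ->].
have [gT_ gx] := ext_columnP _ _ gl; have [hT hx] := ext_columnP _ _ hl.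
have [||f ->] := @translation_conjugate g h; first by rewrite gT_.
  move=> v; rewrite gT_ => Tv.
  have vF : v \in fixed_by T by rewrite unfold_in Tv.
  by have := gx (FixV vF); rewrite -hx.
by rewrite -conjgM memJ_class ?inE.
Qed.

(** If g over T and h over T' are conjugate, then T and T' are conjugate, hence
    equal, and the conjugating element lies over the centralizer of T; by
    [multJ] it moves the restriction to F_T by the action on characters. *)
Lemma columns_parametrized (ts : {set zaut V}) :
  is_transversal ts (classes (Sp C A)) (Sp C A) ->
  column_parametrization ts ext_column.
Proof.
move=> ts_tr; have [_ tsSp _] := and3P ts_tr.
have tsP T : T \in ts -> T \in Sp C A by move/(subsetP tsSp).
have colP c : tag c \in ts -> exists g, g \in ext_column c.
  by case: c => T l /tsP/(ext_column_neq0 l).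
have suppE c g : g \in ext_column c ->
    class_support (ext_column c) [G] = (g ^: [G])%g.
  by case: c => T l; exact: class_support_column.
split.
- by move=> c /colP[g gc]; rewrite (suppE _ _ gc) mem_classes ?inE.
- move=> [T l] [T' l'] /= Tts T'ts; split=> [eq_supp | eq_orb]; last first.
    have := column_orbit_refl (Tagged (fun T => dual C (fixV T)) l).
    rewrite eq_orb => /imsetP[S cS] /= eTl.
    have eT : T = T' by exact: (congr1 tag eTl).
    move: l eq_orb eTl; rewrite {T Tts}eT => l _ eTl.
    have {eTl} -> : l = dual_act S l' by exact: eq_from_Tagged eTl.
    have [SSp cS1] := setIP cS.
    have [k kS] := lin_onto E SSp.
    have [h hc] := colP (Tagged (fun T => dual C (fixV T)) l') T'ts.
    have [hT hx] := ext_columnP _ _ hc.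
    have hkc : (h ^ k^-1)%g \in
        ext_column (Tagged (fun T => dual C (fixV T)) (dual_act S l')).
      apply/ext_columnP; split.
        by rewrite linJ linV kS hT conjgE invgK mulgA (cent1P cS1) mulgK.
      move=> x; have cV : S^-1%g \in 'C[T']%g by rewrite groupV.
      rewrite dual_actE // -hx fix_actE // multJ linV kS // hT.
      by rewrite -zautME -(cent1P cV) zautME fixVP.
    by rewrite (suppE _ _ hc) (suppE _ _ hkc) classGidl ?inE.
  have [g gc] := colP (Tagged (fun T => dual C (fixV T)) l) Tts.
  have [h hc] := colP (Tagged (fun T => dual C (fixV T)) l') T'ts.
  have [gT_ gx] := ext_columnP _ _ gc; have [hT hx] := ext_columnP _ _ hc.
  have := class_refl [set: gT]%G g.
  rewrite -(suppE _ _ gc) eq_supp (suppE _ _ hc) => /imsetP[k _ gk].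
  have TT' : T = (T' ^ lin k)%g by rewrite -gT_ -hT gk linJ.
  have eT : T = T'.
    have TC : T \in (T' ^: Sp C A)%g by rewrite TT' memJ_class ?lin_Sp.
    exact: (transversal_inj ts_tr (mem_classes (tsP _ T'ts)) Tts T'ts TC
              (class_refl _ _)).
  move: l gc gT_ gx eq_supp TT'; rewrite {T Tts}eT => l _ _ gx _ cT'.
  have cS1 : lin k \in 'C[T']%g.
    by apply/cent1P; rewrite /commute [RHS]conjgC -cT'.
  have cSV : (lin k)^-1%g \in 'C[T']%g by rewrite groupV.
  have -> : l = dual_act (lin k)^-1%g l'.
    apply/dualP => x; rewrite dual_actE // invgK -gx -hx fix_actE // gk.
    by rewrite multJ // hT -zautME -(cent1P cS1) zautME fixVP.
  by rewrite column_orbit_act // inE cSV groupV lin_Sp.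
- move=> _ /imsetP[g _ ->].
  have [T Tts /imsetP[S SSp TS]] :=
    transversal_meets ts_tr (mem_classes (lin_Sp E g)).
  have [k kS] := lin_onto E SSp.
  have gkT : lin (g ^ k)%g = T by rewrite linJ kS.
  exists (Tagged (fun T => dual C (fixV T)) (mult_fix (g ^ k)%g)).
    by rewrite /= gkT.
  by rewrite (suppE _ _ (mem_mult_fix_column _)) classGidl ?inE.
Qed.
End Theory.
End Extensions.

(** * Weight spaces and the representations of stabilizers they carry *)

Section Weights.
Variables (C : numClosedFieldType) (A : finZmodType).
Local Notation V := (VA C A).
Variables (gT : finGroupType) (E : sp_extension C A gT).
Local Notation lin := (lin E).
Local Notation mult := (mult E).
Local Notation trans := (translation E).

Section Projectors.
Variables (N : nat) (M : mx_representation C [set: gT]%G N).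

Definition wproj (v : V) : 'M[C]_N :=
  #|{: dual C V}|%:R^-1 *: \sum_(f : dual C V) (f v)^-1 *: M (trans f).

Let card_dual_neq0 : #|{: dual C V}|%:R != 0 :> C.
Proof. by rewrite pnatr_eq0 -lt0n card_zmod_gt0. Qed.

Lemma repM g h : M (g * h)%g = M g *m M h.
Proof. by rewrite repr_mxM ?inE. Qed.

Lemma repVr g : M g *m M g^-1%g = 1%:M.
Proof. by rewrite -repM mulgV repr_mx1. Qed.

Lemma repVl g : M g^-1%g *m M g = 1%:M.
Proof. by rewrite -repM mulVg repr_mx1. Qed.

Lemma rep_neq0 g m (X : 'M_(m, N)) : X *m M g = 0 -> X = 0.
Proof. by move=> X0; rewrite -[X]mulmx1 -(repVr g) mulmxA X0 mul0mx. Qed.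

Lemma translation_wproj f v : M (trans f) *m wproj v = f v *: wproj v.
Proof.
rewrite -scalemxAr scalerA mulrC -scalerA; congr (_ *: _).
rewrite mulmx_sumr scaler_sumr [RHS](reindex_inj (addrI f)).
apply: eq_bigr => f' _; rewrite -scalemxAr -repM -translationD scalerA.
by rewrite dualDE invfM mulrA divff ?dual_neq0 ?mul1r.
Qed.

Lemma mul_wproj v w : wproj v *m wproj w = if v == w then wproj v else 0.
Proof.
rewrite {1}/wproj -scalemxAl mulmx_suml.
under eq_bigr do rewrite -scalemxAl translation_wproj scalerA -dualN -dualD.
rewrite -scaler_suml scalerA; case: eqVneq => [->|vw].
  rewrite addNr; under eq_bigr do rewrite dual0.
  by rewrite sumr_const mulVf ?scale1r.
by rewrite sum_dual ?mulr0 ?scale0r // addrC subr_eq0 eq_sym.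
Qed.

Lemma sum_wproj : \sum_v wproj v = 1%:M.
Proof.
rewrite /wproj -scaler_sumr exchange_big (bigD1 0) //=.
rewrite [X in _ + X]big1 ?addr0 => [|f f0]; last first.
  rewrite -scaler_suml; under eq_bigr do rewrite -dualNE.
  by rewrite sum_dual_B ?scale0r // oppr_eq0.
rewrite -scaler_suml; under eq_bigr do rewrite dual0E invr1.
rewrite sumr_const -(card_dual C V) scalerA mulVf // scale1r.
by rewrite translation0 repr_mx1.
Qed.

Lemma rep_wproj g v : M g *m wproj v = wproj (lin g v) *m M g.
Proof.
have compK f : dual_comp (dual_comp f (lin g)^-1%g) (lin g) = f.
  by apply/dualP => x; rewrite !dual_compE zautK.
have compKV f : dual_comp (dual_comp f (lin g)) (lin g)^-1%g = f.
  by apply/dualP => x; rewrite !dual_compE zautKV.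
rewrite /wproj -scalemxAl -scalemxAr; congr (_ *: _).
rewrite mulmx_sumr mulmx_suml (reindex_onto (fun f => dual_comp f (lin g))
          (fun f => dual_comp f (lin g)^-1%g)) => [|f _]; last exact: compK.
apply: eq_big => [f|f _]; first by rewrite compKV eqxx.
by rewrite -scalemxAr -scalemxAl dual_compE -!repM mul_translation.
Qed.

Lemma wprojJ g v : M g *m wproj v *m M g^-1%g = wproj (lin g v).
Proof. by rewrite rep_wproj -mulmxA repVr mulmx1. Qed.

Lemma module_wproj m (U : 'M_(m, N)) v : mxmodule M U -> (U *m wproj v <= U)%MS.
Proof.
move=> /mxmoduleP modU; rewrite -scalemxAr scalemx_sub // mulmx_sumr.
by apply: summx_sub => f _; rewrite -scalemxAr scalemx_sub ?modU ?inE.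
Qed.

(** Fourier inversion over the translations: the trace of g on a single weight
    space is determined by the character of M. *)
Lemma trace_wproj g v : \tr (M g *m wproj v) =
  #|{: dual C V}|%:R^-1 *
    \sum_(f : dual C V) (f v)^-1 * rep_char M (g * trans f)%g.
Proof.
rewrite -scalemxAr mxtraceZ mulmx_sumr raddf_sum; congr (_ * _).
by apply: eq_bigr => f _ /=; rewrite -scalemxAr mxtraceZ /rep_char inE repM.
Qed.

Lemma trace_wproj_moved g v : lin g v != v -> \tr (M g *m wproj v) = 0.
Proof.
move=> gv; have := mul_wproj v v; rewrite eqxx => <-.
by rewrite mulmxA mxtrace_mulC rep_wproj mulmxA mul_wproj eq_sym (negbTE gv)
  mul0mx mxtrace0.
Qed.
End Projectors.

(** The rows of I and the columns of J are dual bases of the weight space of u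
    for the actions of M from the right and from the left. *)
Definition carries N (M : mx_representation C [set: gT]%G N) u n
    (s : mx_representation C (SpStab_group u) n) : Prop :=
  (forall v, v \notin SpOrbit u -> wproj M v = 0) /\
  exists (I : 'M_(n, N)) (J : 'M_(N, n)),
    [/\ I *m J = 1%:M, J *m I = wproj M u
      & forall g, lin g \in SpStab u ->
          I *m M g *m J = mult g u *: s (lin g)].

Lemma SpOrbitP (u v : V) :
  reflect (exists2 T : zaut V, T \in Sp C A & T u = v) (v \in SpOrbit u).
Proof. by apply: (iffP imsetP) => -[T TS e]; exists T. Qed.

Lemma SpOrbit_refl (u : V) : u \in SpOrbit u.
Proof. by apply/SpOrbitP; exists 1%g; rewrite ?group1 ?zaut1E. Qed.

Lemma SpStab_conj (u v : V) (S T : zaut V) : S \in Sp C A -> T \in Sp C A ->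
  S u = v -> T v = v -> (S^-1 * T * S)%g \in SpStab u.
Proof.
move=> SS TS Su Tv; apply/setIdP; split; first by rewrite !groupM ?groupV.
by rewrite !zautME Su Tv -Su zautK.
Qed.

Section Carried.
Variables (N : nat) (M : mx_representation C [set: gT]%G N).
Variables (u : V) (n : nat) (s : mx_representation C (SpStab_group u) n).
Hypothesis Ms : carries M s.

(** An element over S carries the weight space of u to that of v = S u, where g
    acts as its conjugate does on the weight space of u. *)
Lemma trace_wproj_fixed g v (S : zaut V) : S \in Sp C A -> S u = v ->
  lin g v = v ->
  \tr (M g *m wproj M v) = mult g v * rep_char s (S^-1 * lin g * S)%g.
Proof.
case: Ms => _ [I [J [_ JI IJs]]] SS Su gv; have [k kS] := lin_onto E SS.
have gk : lin (g ^ k)%g = (S^-1 * lin g * S)%g by rewrite linJ kS conjgE mulgA.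
have gkS : lin (g ^ k)%g \in SpStab u.
  by rewrite gk; apply: SpStab_conj gv; rewrite ?lin_Sp.
rewrite /rep_char -gk gkS -mxtraceZ -Su -kS -(@multJ _ _ _ E) ?kS ?Su //.
rewrite -IJs // [RHS]mxtrace_mulC mulmxA JI -Su -kS -wprojJ conjgE !repM.
by rewrite [RHS]mxtrace_mulC !mulmxA [LHS]mxtrace_mulC !mulmxA.
Qed.

Lemma carries_char g (t : V -> zaut V) :
  (forall x, x \in SpOrbit u -> t x \in Sp C A /\ t x u = x) ->
  rep_char M g = \sum_(x : fixV (lin g) | val x \in SpOrbit u)
    mult g (val x) * rep_char s ((t (val x))^-1 * lin g * t (val x))%g.
Proof.
move=> tP; rewrite /rep_char inE mulr1n -[M g]mulmx1 -(sum_wproj M).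
rewrite mulmx_sumr raddf_sum (bigID (fun v => v \in SpOrbit u)) /=.
rewrite [X in _ + X]big1 ?addr0 => [|v vu]; last first.
  by case: Ms => /(_ v vu) -> _; rewrite mulmx0 mxtrace0.
rewrite (bigID (mem (fixed_by (lin g)))) /= [X in _ + X]big1 ?addr0; last first.
  by move=> v /andP[_ gv]; apply: trace_wproj_moved.
rewrite (reindex_onto val (insubd (0 : fixV (lin g)))) => [|v /andP[_ gv]] /=.
  apply: eq_big => [x|x /andP[/andP[xu _] _]].
    by rewrite valKd eqxx andbT (valP x) andbT.
  have [tS tu] := tP _ xu.
  by rewrite (trace_wproj_fixed tS tu) // fixVP.
by rewrite insubdK.
Qed.

Lemma carries_column_char (t : V -> zaut V) (T : zaut V)
    (l : dual C (fixV T)) g :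
  (forall x, x \in SpOrbit u -> t x \in Sp C A /\ t x u = x) ->
  g \in class_support (ext_column E (Tagged (fun T => dual C (fixV T)) l))
          [set: gT] ->
  rep_char M g = \sum_(x : fixV T | val x \in SpOrbit u)
    l x * rep_char s ((t (val x))^-1 * T * t (val x))%g.
Proof.
move=> tP /imset2P[h k /ext_columnP[hT hl] _ ->{g}].
have -> : rep_char M (h ^ k)%g = rep_char M h.
  rewrite /rep_char !inE !mulr1n conjgE !repM mxtrace_mulC -mulmxA.
  by rewrite repVr mulmx1.
move: l hl; rewrite -hT => l hl; rewrite (carries_char h tP).
by apply: eq_bigr => x _; rewrite hl.
Qed.

Lemma carries_degree_gt0 : mx_irreducible M -> (0 < n)%N.
Proof.
case/mx_irrP => N0 _; case: n s Ms => // s0 [M0 [I [J [_ JI _]]]].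
have u0 : wproj M u = 0 by rewrite -JI [J]thinmx0 mul0mx.
suff: 1%:M = 0 :> 'M[C]_N.
  by move/matrixP/(_ (Ordinal N0) (Ordinal N0))/eqP; rewrite !mxE eqxx oner_eq0.
rewrite -(sum_wproj M) big1 // => v _.
have [/SpOrbitP[T TS <-]|/M0//] := boolP (v \in SpOrbit u).
have [g <-] := lin_onto E TS.
by rewrite -wprojJ u0 mulmx0 mul0mx.
Qed.

(** A nonzero submodule U of M meets some weight space, hence that of u, in a
    nonzero submodule for s, that is, in all of it; the translates of the weight
    space of u span M. *)
Lemma carries_irr : mx_irreducible s -> mx_irreducible M.
Proof.
case/mx_irrP => n0 irr_s; case: Ms => M0 [I [J [IJ JI IJs]]].
apply/mx_irrP; split.
  case: N M I J IJ {M0 JI IJs} => // M' I J IJ.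
  have /matrixP/(_ (Ordinal n0) (Ordinal n0))/eqP := IJ.
  by rewrite (flatmx0 J) mulmx0 !mxE eqxx eq_sym oner_eq0.
move=> U modU U0; have modUP := mxmoduleP modU.
have UPu : U *m wproj M u != 0.
  apply: contraNneq U0 => Uu; rewrite -[U]mulmx1 -(sum_wproj M) mulmx_sumr.
  rewrite big1 // => v _.
  have [/SpOrbitP[T TS <-]|/M0->] := boolP (v \in SpOrbit u);
    last exact: mulmx0.
  have [g <-] := lin_onto E TS; rewrite -wprojJ !mulmxA.
  have /submxP[D ->] : (U *m M g <= U)%MS by rewrite modUP ?inE.
  by rewrite -(mulmxA D) Uu mulmx0 mul0mx.
have fullUJ : row_full (U *m J).
  rewrite -(eq_row_full (genmxE _)); apply: irr_s; last first.
    rewrite (eqmx_eq0 (genmxE _)).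
    by apply: contraNneq UPu => UJ0; rewrite -JI mulmxA UJ0 mul0mx.
  rewrite (eqmx_module _ (genmxE _)); apply/mxmoduleP => T TS.
  have [TSp _] := setIdP TS; have [g gT_] := lin_onto E TSp.
  have -> : s T = (mult g u)^-1 *: (I *m M g *m J).
    by rewrite IJs gT_ // scalerA mulVf ?scale1r ?mult_neq0.
  rewrite -scalemxAr scalemx_sub // !mulmxA submxMr //.
  rewrite -(mulmxA U) JI; apply: submx_trans (modUP g _); rewrite ?inE //.
  by rewrite submxMr // module_wproj.
have IU : (I <= U)%MS.
  apply: submx_trans (module_wproj u modU); rewrite -JI mulmxA.
  by rewrite -{1}[I]mul1mx submxMr // sub1mx.
rewrite -sub1mx -(sum_wproj M); apply: summx_sub => v _.
have [/SpOrbitP[T TS <-]|/M0->] := boolP (v \in SpOrbit u); last exact: sub0mx.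
have [g <-] := lin_onto E TS; rewrite -wprojJ -JI !mulmxA.
apply: submx_trans (modUP g^-1%g _); rewrite ?inE //.
by rewrite submxMr // mulmx_sub.
Qed.

(** A nonzero s-submodule Y of the weight space of u generates M.  Elements
    outside the stabilizer of u move Y to other weight spaces, so the part of
    weight u of the module generated by Y is Y itself. *)
Lemma irr_carried : mx_irreducible M -> mx_irreducible s.
Proof.
move=> irrM; apply/mx_irrP; split; first exact: carries_degree_gt0.
case/mx_irrP: irrM => _ irrM; case: Ms => M0 [I [J [IJ JI IJs]]].
move=> Y /mxmoduleP modY Y0.
pose U := (\sum_(g : gT) <<Y *m I *m M g>>)%MS.
have IP : I = I *m wproj M u by rewrite -JI mulmxA IJ mul1mx.
have PJ : J = wproj M u *m J by rewrite -JI -mulmxA IJ mulmx1.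
have fullU : row_full U.
  apply: irrM.
    apply/mxmoduleP => h _; rewrite sumsmxMr; apply/sumsmx_subP => g _.
    rewrite (eqmxMr _ (genmxE _)) -mulmxA -repM.
    by rewrite (sumsmx_sup (g * h)%g) // genmxE.
  apply: contraNneq Y0 => U0; rewrite -[Y]mulmx1 -IJ mulmxA.
  suff -> : Y *m I = 0 by rewrite mul0mx.
  apply/eqP; rewrite -submx0 -U0 (sumsmx_sup 1%g) //.
  by rewrite genmxE repr_mx1 mulmx1.
rewrite -sub1mx -IJ; apply: submx_trans (_ : (U *m J <= Y)%MS).
  by rewrite submxMr // (submx_trans (submx1 _)) // sub1mx.
rewrite sumsmxMr_gen; apply/sumsmx_subP => g _.
rewrite genmxE (eqmxMr _ (genmxE _)).
have -> : Y *m I *m M g *m J = Y *m (I *m M g *m J) by rewrite !mulmxA.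
have [gu|gu] := boolP (lin g \in SpStab u).
  by rewrite IJs // -scalemxAr scalemx_sub // modY.
have gu' : u != lin g u.
  by apply: contra gu; rewrite eq_sym => gu; apply/setIdP; rewrite lin_Sp.
rewrite (_ : I *m M g *m J = 0) ?mulmx0 ?sub0mx //.
rewrite IP PJ -!mulmxA (mulmxA (M g)) rep_wproj -mulmxA.
by rewrite (mulmxA (wproj M u)) mul_wproj (negbTE gu') mul0mx mulmx0.
Qed.
End Carried.
End Weights.

(** * Rows: the method of little groups *)

Lemma idempotent_splitting (F : fieldType) N (P : 'M[F]_N) : P *m P = P ->
  exists n (I : 'M_(n, N)) (J : 'M_(N, n)), I *m J = 1%:M /\ J *m I = P.
Proof.
move=> PP; exists (\rank P), (row_base P), (col_base P).
move: (row_base_free P) (col_base_full P) (mulmx_base P).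
move: (row_base P) (col_base P) => I J freeI fullJ JI; split=> //.
apply: (row_free_inj freeI); apply: (row_full_inj fullJ).
by rewrite mul1mx !mulmxA JI -mulmxA JI.
Qed.

Section Rows.
Variables (C : numClosedFieldType) (A : finZmodType).
Local Notation V := (VA C A).
Variables (gT : finGroupType) (E : sp_extension C A gT).
Local Notation lin := (lin E).
Local Notation mult := (mult E).
Local Notation trans := (translation E).

Section Little_group.
Variables (N : nat) (M : mx_representation C [set: gT]%G N) (u : V).
Local Notation P := (wproj E M).

Variables (n : nat) (I : 'M[C]_(n, N)) (J : 'M[C]_(N, n)).
Hypotheses (IJ : I *m J = 1%:M) (JI : J *m I = P u).

Let PJ : P u *m J = J. Proof. by rewrite -JI -mulmxA IJ mulmx1. Qed.

(** The default value is not taken on Sp(V), onto which lin is surjective. *)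
Definition lift_Sp (T : zaut V) : gT := odflt 1%g [pick g | lin g == T].

(** Another lift of T multiplies M and mult at the weight u by the same scalar,
    so the choice of the lift does not matter. *)
Definition little_mx (T : zaut V) : 'M[C]_n :=
  (mult (lift_Sp T) u)^-1 *: (I *m M (lift_Sp T) *m J).

Let little_mxE g : I *m M g *m J = mult g u *: little_mx (lin g).
Proof.
rewrite /little_mx /lift_Sp; case: pickP => [h /eqP hg | /(_ g)];
  last by rewrite eqxx.
have -> : g = (h * trans (mult_ratio hg))%g.
  apply: (@ext_inj _ _ _ E) => [|v].
    by rewrite linM lin_translation mulg1.
  rewrite multM lin_translation zaut1E mult_translation mult_ratioE.
  by rewrite mulrC divfK ?mult_neq0.
rewrite multM lin_translation zaut1E mult_translation repM.
rewrite -!mulmxA -[in LHS]PJ (mulmxA (M (trans _))) translation_wproj.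
rewrite -scalemxAl PJ -!scalemxAr scalerA mulrAC mulfV ?mult_neq0 //.
by rewrite mul1r.
Qed.

Lemma little_mx_repr : mx_repr (SpStab u) little_mx.
Proof.
have sE g : little_mx (lin g) = (mult g u)^-1 *: (I *m M g *m J).
  by rewrite little_mxE scalerA mulVf ?scale1r ?mult_neq0.
split=> [|T S TS SS].
  by rewrite -(lin1 E) sE mult1 invr1 scale1r repr_mx1 mulmx1 IJ.
have [/setIdP[TSp _] /setIdP[SSp /eqP Su]] := (TS, SS).
have [g gT_] := lin_onto E TSp; have [h hS] := lin_onto E SSp.
rewrite -gT_ -hS -linM !sE multM hS Su -scalemxAl -scalemxAr scalerA.
rewrite invfM mulrC repM; congr (_ *: _).
have hP : M h *m P u = P u *m M h by rewrite rep_wproj hS Su.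
have hJ : M h *m J = J *m (I *m M h *m J).
  by rewrite !mulmxA JI -hP -mulmxA PJ.
by rewrite -!mulmxA [in LHS]hJ !mulmxA.
Qed.

Definition little_repr :=
  @MxRepresentation C _ (SpStab_group u) n little_mx little_mx_repr.

(** The sum of the weight spaces over one orbit is a submodule. *)
Lemma irr_carries_little : mx_irreducible M -> P u != 0 ->
  carries E M little_repr.
Proof.
case/mx_irrP => _ irrM u0; split; last first.
  by exists I, J; split=> // g _; rewrite little_mxE.
move=> v vu; pose Q := \sum_(w in SpOrbit u) P w.
have fullQ : row_full Q.
  apply: irrM.
    apply/mxmoduleP => g _; suff -> : Q *m M g = M g *m Q by rewrite submxMl.
    rewrite mulmx_suml mulmx_sumr (reindex_inj (@perm_inj _ (lin g))) /=.
    apply: eq_big => [w|w _]; last by rewrite rep_wproj.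
    apply/SpOrbitP/SpOrbitP => -[T TS Tu].
      exists ((lin g)^-1 * T)%g; first by rewrite groupM ?groupV ?lin_Sp.
      by rewrite zautME Tu zautK.
    by exists (lin g * T)%g; rewrite ?groupM ?lin_Sp // zautME Tu.
  apply: contraNneq u0 => Q0; have: Q *m P u = 0 by rewrite Q0 mul0mx.
  rewrite mulmx_suml (bigD1 u) ?SpOrbit_refl //= mul_wproj eqxx big1 ?addr0.
    by move->.
  by move=> w /andP[_ wu]; rewrite mul_wproj (negbTE wu).
have /submxP[D D1] : (1%:M <= Q)%MS by rewrite sub1mx.
rewrite -[P v]mul1mx D1 -mulmxA mulmx_suml big1 ?mulmx0 // => w wu.
by rewrite mul_wproj; case: eqVneq vu => // <-; rewrite wu.
Qed.
End Little_group.

Section Parametrization.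
Variable us : {set V}.
Hypothesis us_tr : is_transversal us [set SpOrbit u | u : V] [set: V].

Lemma irr_carries_ex N (M : mx_representation C [set: gT]%G N) :
  mx_irreducible M ->
  exists u n (s : mx_representation C (SpStab_group u) n),
    u \in us /\ carries E M s.
Proof.
move=> irrM; have [N0 _] := (mx_irrP _).1 irrM.
have [v v0] : exists v, wproj E M v != 0.
  apply/existsP; apply: contraT; rewrite negb_exists => /forallP P0.
  have /matrixP/(_ (Ordinal N0) (Ordinal N0))/eqP := sum_wproj E M.
  rewrite big1 => [|w _]; first by rewrite !mxE eqxx eq_sym oner_eq0.
  by apply/eqP; have := P0 w; rewrite negbK.
have vO : SpOrbit v \in [set SpOrbit u | u : V] by apply: imset_f.
have [u uus /SpOrbitP[T TS Tv]] := transversal_meets us_tr vO.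
have [g gT_] := lin_onto E TS.
have PP : wproj E M u *m wproj E M u = wproj E M u by rewrite mul_wproj eqxx.
have [n [I [J [IJ JI]]]] := idempotent_splitting PP.
exists u, n, (little_repr IJ JI); split=> //; apply: irr_carries_little => //.
apply: contraNneq v0; rewrite -Tv -gT_ -wprojJ => /rep_neq0 M0.
by rewrite -[wproj E M v]mul1mx -(repVl M g) -mulmxA M0 mulmx0.
Qed.

(** The trace of the identity on the weight space of u detects the orbit, and
    the trace of g on it is mult g u times the character of s. *)
Lemma carries_char_inj N (M : mx_representation C [set: gT]%G N)
    N' (M' : mx_representation C [set: gT]%G N')
    u n (s : mx_representation C (SpStab_group u) n)
    u' n' (s' : mx_representation C (SpStab_group u') n') :
  carries E M s -> carries E M' s' -> (0 < n)%N -> u \in us -> u' \in us ->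
  rep_char M =1 rep_char M' -> u = u' /\ rep_char s =1 rep_char s'.
Proof.
move=> Ms Ms' n0 uus u'us MM'.
have trE g v : \tr (M g *m wproj E M v) = \tr (M' g *m wproj E M' v).
  rewrite !trace_wproj; congr (_ * _); apply: eq_bigr => f _.
  by rewrite MM'.
have tr_fixed L (M2 : mx_representation C [set: gT]%G L) k
    (s2 : mx_representation C (SpStab_group u) k) g : carries E M2 s2 ->
    lin g u = u -> \tr (M2 g *m wproj E M2 u) = mult g u * rep_char s2 (lin g).
  move=> Ms2 gu; have one := group1 (Sp_group C A).
  by rewrite (trace_wproj_fixed Ms2 one (zaut1E u) gu) invg1 mulg1 mul1g.
have ss' T (TS : T \in SpStab u)
    (s2 : mx_representation C (SpStab_group u) n') :
    carries E M' s2 -> rep_char s T = rep_char s2 T.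
  move=> Ms2; have /setIdP[TSp /eqP Tu] := TS; have [g gT_] := lin_onto E TSp.
  have gu : lin g u = u by rewrite gT_.
  have := trE g u.
  rewrite (tr_fixed _ _ _ _ _ Ms gu) (tr_fixed _ _ _ _ _ Ms2 gu) gT_.
  by move/(mulfI (mult_neq0 E g u)).
have uu' : u = u'.
  have uO : u \in SpOrbit u'.
    apply: contraT => uu'; have := trE 1%g u.
    have [/(_ u uu')-> _] := Ms'.
    have g1 : lin 1%g u = u by rewrite lin1 zaut1E.
    rewrite (tr_fixed _ _ _ _ _ Ms g1) mult1 mul1r mulmx0 mxtrace0 lin1.
    rewrite /rep_char repr_mx1 mxtrace1.
    by rewrite group1 => /eqP; rewrite pnatr_eq0 eqn0Ngt n0.
  have u'O : SpOrbit u' \in [set SpOrbit u | u : V] by apply: imset_f.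
  exact: (transversal_inj us_tr u'O uus u'us uO (SpOrbit_refl u')).
move: s' Ms'; rewrite -uu' => s' Ms'; split=> // T.
have [TS|TS] := boolP (T \in SpStab u); first exact: ss'.
by rewrite /rep_char (negbTE TS).
Qed.

Lemma carries_char_eq N (M : mx_representation C [set: gT]%G N)
    N' (M' : mx_representation C [set: gT]%G N') u
    n (s : mx_representation C (SpStab_group u) n)
    n' (s' : mx_representation C (SpStab_group u) n') :
  carries E M s -> carries E M' s' ->
  rep_char s =1 rep_char s' -> rep_char M =1 rep_char M'.
Proof.
move=> Ms Ms' ss' g.
pose t v : zaut V := odflt 1%g [pick T in Sp C A | (T : zaut V) u == v].
have tP v : v \in SpOrbit u -> t v \in Sp C A /\ t v u = v.
  rewrite /t; case: pickP => [T /andP[TS /eqP Tu] // | no /SpOrbitP[T TS Tu]].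
  by have := no T; rewrite TS Tu eqxx.
rewrite (carries_char Ms g tP) (carries_char Ms' g tP).
by apply: eq_bigr => x _; rewrite ss'.
Qed.

Lemma rows_parametrized (P : forall u n, mx_representation C (SpStab u) n ->
    mx_representation C [set: gT] (row_degree u n)) :
  (forall u n (s : mx_representation C (SpStab_group u) n),
     carries E (P u n s) s) ->
  row_parametrization us P.
Proof.
move=> Ps; split.
- by move=> u n s _; apply: carries_irr (Ps u n s).
- move=> u n s u' n' s' uus irr_s u'us irr_s'; split=> [|[uu']].
    have [n0 _] := (mx_irrP _).1 irr_s.
    exact: (carries_char_inj (Ps u n s) (Ps u' n' s') n0 uus u'us).
  move: s' {irr_s'}; rewrite -uu' => s'.
  exact: carries_char_eq (Ps u n s) (Ps u n' s').
move=> m M irrM; have [u [n [s [uus Ms]]]] := irr_carries_ex irrM.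
exists u, n, s; split=> //; first exact: irr_carried Ms irrM.
exact: carries_char_eq Ms (Ps u n s) _.
Qed.
End Parametrization.
End Rows.

(** * The affine symplectic group and the Clifford group *)

Section Instances.
Variables (C : numClosedFieldType) (A : finZmodType).
Local Notation V := (VA C A).

Lemma asp_multM (g h : asp C A) v :
  asp_chi (g * h)%g v = asp_chi g (asp_lin h v) * asp_chi h v.
Proof. by rewrite [LHS]dualDE dual_compE. Qed.

Definition asp_extension : sp_extension C A (asp C A).
Proof.
refine (@SpExtension C A (asp C A) (@asp_lin C A) (fun g => asp_chi g)
  (@asp_translation C A) (fun _ _ _ => 1) _ _ _ _ _ _ _ _ _ _) => //.
- exact: asp_linP.
- by move=> T TS; exists (@ASp C A (T, 0) TS).
- by move=> g v; apply: dual_norm.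
- exact: asp_multM.
- by move=> g u v; rewrite mul1r dualD.
- by move=> g h gh /dualP; apply: aspP.
Defined.

(** The defect of T is a bicharacter, hence a 2-cocycle, and it is symmetric
    because T preserves omega. *)
Lemma cl_lin_onto (T : zaut V) : T \in Sp C A ->
  exists g : clifford C A, cl_lin g = T.
Proof.
move=> /SpP TS; pose c (u v : V) := beta (T u) (T v) * (beta u v)^-1.
have [||u v w|lam lam1 lamD] := @symmetric_cocycle_coboundary C V c.
- by move=> u v; rewrite normrM normfV !beta_norm invr1 mulr1.
- move=> u v; have := TS u v; rewrite /omega /c => /eqP.
  rewrite eqr_div ?beta_neq0 // => /eqP e; apply/eqP.
  by rewrite eqr_div ?beta_neq0 // e mulrC.
- rewrite /c !zautD !betaDl !betaDr; field.
  by rewrite !beta_neq0.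
have cl : is_clifford (T, lam) by apply: is_cliffordP.
by exists (Clifford cl).
Qed.

Lemma cl_translation_subproof (f : dual C V) :
  is_clifford (1%g : zaut V, f : {ffun V -> C}).
Proof.
apply: is_cliffordP => [u|u v] /=; first exact: dual_norm.
by rewrite !zaut1E mulfV ?beta_neq0 // mul1r dualD.
Qed.
Definition cl_translation f : clifford C A :=
  Clifford (cl_translation_subproof f).

Definition cl_extension : sp_extension C A (clifford C A).
Proof.
refine (@SpExtension C A (clifford C A) (@cl_lin C A) (fun g => cl_fun g)
  cl_translation (fun T u v => beta (T u) (T v) * (beta u v)^-1)
  _ _ _ _ _ _ _ _ _ _) => //.
- exact: cl_lin_Sp.
- exact: cl_lin_onto.
- exact: cl_norm.
- by move=> g h v; rewrite [LHS]ffunE.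
- exact: clD.
- by move=> T u v -> ->; rewrite mulfV ?beta_neq0.
- exact: cliffordP.
Defined.

Section Induced.
Variables (u : V) (n : nat) (s : mx_representation C (SpStab_group u) n).
Local Notation H := (ASpStab_group u).
Local Notation K := (coset_count H).
Local Notation t := (@coset_rep _ H).
Local Notation ts := (@tilde_repr C A u n s : mx_representation C H n).
Local Notation M := (Pi_ASp s : mx_representation C [set: asp C A]%G _).
Local Notation x i := (asp_lin (t i) u).

Let mem_H (g : asp C A) : (g \in H) = (asp_lin g u == u).
Proof. by rewrite mem_ASpStab in_set asp_linP. Qed.

Let x_inj : injective (fun i => x i).
Proof.
move=> i j xij; apply: (@coset_rep_inj _ H (t j)).
  by rewrite mem_H [asp_lin _]/= zautME -xij zautK.
by rewrite mulVg group1.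
Qed.

Let translation_block f i j :
  ext0_mx ts ((t i)^-1 * asp_translation f * t j)%g =
  if i == j then (f (x i))%:M else 0.
Proof.
rewrite /ext0_mx; case: (eqVneq i j) => [<-|ij].
  have -> : ((t i)^-1 * asp_translation f * t i)%g =
      asp_translation (dual_comp f (asp_lin (t i))).
    by rewrite -mulgA -(mul_translation asp_extension) mulKg.
  have trH : asp_translation (dual_comp f (asp_lin (t i))) \in H.
    by rewrite mem_H zaut1E.
  rewrite trH -[ts _]/(tilde_mx s _) /tilde_mx /asp_translation.
  rewrite [asp_lin _]/= repr_mx1 scalemx1 -[asp_chi _]/(dual_comp _ _).
  by rewrite dual_compE.
rewrite ifF //; apply: contraNF ij.
rewrite mem_H => /eqP h; apply/eqP/x_inj; move: h.
rewrite -[asp_lin _]/((asp_lin (t i))^-1 * 1 * asp_lin (t j))%g mulg1 zautME.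
move=> {2}<-.
by rewrite zautKV.
Qed.

Let Pi_block g : M g =
  \mxblock_(i < K, j < K) ext0_mx ts ((t i)^-1 * g * t j)%g.
Proof. by []. Qed.

(** The coset t_i H is the block of weight t_i u, because a translation acts on
    it by the scalar f(t_i u). *)
Lemma Pi_ASp_wproj v : wproj asp_extension M v =
  \mxblock_(i < K, j < K)
     (if (i == j) && (x i == v) then 1%:M else 0 : 'M[C]_n).
Proof.
apply/mxblockP => i j; rewrite mxblockK.
transitivity (#|{: dual C V}|%:R^-1 *: \sum_(f : dual C V) (f v)^-1 *:
                submxblock (M (asp_translation f)) i j).
  apply/matrixP => k l; rewrite !(mxE, summxE); congr (_ * _).
  by apply: eq_bigr => f _; rewrite !mxE.
under eq_bigr do rewrite Pi_block mxblockK translation_block.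
case: eqVneq => [_|_] /=; last first.
  by under eq_bigr do rewrite scaler0; rewrite big1 ?scaler0.
under eq_bigr do rewrite scale_scalar_mx -dualN -dualD.
rewrite -raddf_sum scale_scalar_mx; case: eqVneq => [->|xiv].
  rewrite addNr; under eq_bigr do rewrite dual0.
  rewrite sumr_const mulVf //.
  by rewrite pnatr_eq0 -lt0n card_zmod_gt0.
by rewrite sum_dual ?mulr0 ?raddf0 // addrC subr_eq0.
Qed.

(** The weight space of u is the block of the trivial coset. *)
Lemma Pi_ASp_carries : carries asp_extension M s.
Proof.
have [i0 h0] := coset_rep_ex H 1%g; rewrite mulg1 groupV in h0.
have x0 : x i0 = u by move: h0; rewrite mem_H => /eqP.
split.
  move=> v vu; apply/mxblockP => i j; rewrite Pi_ASp_wproj mxblockK submxblock0.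
  case: ifP => // /andP[_ /eqP xiv].
  case/negP: vu; rewrite -xiv; apply/SpOrbitP.
  by exists (asp_lin (t i)); rewrite ?asp_linP.
pose I0 : 'M[C]_(n, \sum_(i < K) n) :=
  \mxrow_(i < K) (if i == i0 then 1%:M else 0 : 'M[C]_n).
pose J0 : 'M[C]_(\sum_(i < K) n, n) :=
  \mxcol_(i < K) (if i == i0 then 1%:M else 0 : 'M[C]_n).
have IJ0 : I0 *m J0 = 1%:M.
  rewrite mul_mxrow_mxcol (bigD1 i0) //= eqxx mulmx1 big1 ?addr0 // => i ii0.
  by rewrite (negbTE ii0) mul0mx.
have IMJ0 g : I0 *m M g *m J0 = ext0_mx ts ((t i0)^-1 * g * t i0)%g.
  rewrite Pi_block mul_mxrow_mxblock mul_mxrow_mxcol (bigD1 i0) //= eqxx mulmx1.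
  rewrite [X in _ + X]big1 ?addr0 => [|i ii0]; last first.
    by rewrite (negbTE ii0) mulmx0.
  rewrite (bigD1 i0) //= eqxx mul1mx big1 ?addr0 // => i ii0.
  by rewrite (negbTE ii0) mul0mx.
have JI0 : J0 *m I0 = wproj asp_extension M u.
  rewrite mul_mxcol_mxrow Pi_ASp_wproj; apply: eq_mxblock => i j.
  have -> : (x i == u) = (i == i0) by rewrite -(inj_eq x_inj) x0.
  have [->|ii0] := eqVneq i i0; last by rewrite mul0mx andbF.
  by rewrite andbT eq_sym mul1mx.
(* The representative t i0 of the coset H need not be 1: on its block an
   element g of H acts as the conjugate of g by t i0, which is undone here. *)
exists (ts (t i0) *m I0), (J0 *m ts (t i0)^-1%g); split.
- rewrite mulmxA -(mulmxA _ I0) IJ0 mulmx1 -repr_mxM ?groupV //.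
  by rewrite mulgV repr_mx1.
- rewrite -mulmxA (mulmxA _ _ I0) -repr_mxM ?groupV // mulVg repr_mx1 mul1mx.
  exact: JI0.
move=> g gu; have gH : g \in H by rewrite mem_ASpStab.
transitivity (ts (t i0) *m (I0 *m M g *m J0) *m ts (t i0)^-1%g).
  by rewrite !mulmxA.
rewrite IMJ0 /ext0_mx ifT ?groupM ?groupV //.
by rewrite -!repr_mxM ?groupM ?groupV // !mulgA mulgV mul1g mulgK.
Qed.
End Induced.

(** Both groups have the same translations, acting in the same way, so the
    weight spaces are the same; on that of u the functor only inserts the scalar
    lambda(u). *)
Lemma F_repr_carries N (pi : mx_representation C [set: asp C A]%G N) u n
    (s : mx_representation C (SpStab_group u) n) :
  carries asp_extension pi s ->
  carries cl_extension
    (F_repr pi : mx_representation C [set: clifford C A]%G N) s.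
Proof.
have Ftr f : F_mx pi (cl_translation f) = pi (asp_translation f).
  apply: (@weight_ext _ _ _ pi) => v xi xiv; rewrite (F_mx_weight _ xiv) xiv.
  have -> : asp_of_cl (cl_translation f) = 1%g by apply: val_inj.
  by rewrite repr_mx1 mul1mx.
have wprojE v : wproj cl_extension
    (F_repr pi : mx_representation C [set: clifford C A]%G N) v =
    wproj asp_extension pi v.
  by congr (_ *: _); apply: eq_bigr => f _; congr (_ *: _); exact: Ftr.
case=> pi0 [I [J [IJ JI IJs]]]; split=> [v vu|]; first by rewrite wprojE pi0.
exists I, J; split=> // [|g gu]; first by rewrite wprojE.
have PJ : wproj asp_extension pi u *m J = J by rewrite -JI -mulmxA IJ mulmx1.
have sumJ : (\sum_v cl_fun g v *: wproj asp_extension pi v) *m J =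
    cl_fun g u *: J.
  rewrite -[in LHS]PJ mulmxA mulmx_suml (bigD1 u) //= -scalemxAl mul_wproj eqxx.
  rewrite big1 ?addr0 => [|v vu]; first by rewrite -scalemxAl PJ.
  by rewrite -scalemxAl mul_wproj (negbTE vu) scaler0.
rewrite -[F_repr pi g]/(pi (asp_of_cl g) *m
                        \sum_v cl_fun g v *: wproj asp_extension pi v).
rewrite -!mulmxA sumJ -!scalemxAr mulmxA IJs //.
by rewrite [mult _ _ _]dual0E scale1r.
Qed.
End Instances.

(** * The common character table *)

Theorem theorem4p5 (R : realType) (A : finZmodType)
    (us : {set VA R[i] A}) (ts : {set zaut (VA R[i] A)})
    (us_transversal :
       is_transversal us [set SpOrbit u | u : VA R[i] A] [set: VA R[i] A])
    (ts_transversal : is_transversal ts (classes (Sp R[i] A)) (Sp R[i] A)) :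
  [/\ row_parametrization us (@Pi_Cl R[i] A)
        /\ row_parametrization us (@Pi_ASp R[i] A),
      column_parametrization ts (@cl_column R[i] A)
        /\ column_parametrization ts (@asp_column R[i] A)
    & forall (u : VA R[i] A) (n : nat)
             (sigma : mx_representation R[i] (SpStab_group u) n)
             (T : zaut (VA R[i] A)) (l : dual R[i] (fixV T))
             (t : VA R[i] A -> zaut (VA R[i] A)),
        u \in us -> mx_irreducible sigma -> T \in ts ->
        (forall x, x \in SpOrbit u -> t x \in Sp R[i] A /\ t x u = x) ->
        let value := \sum_(x : fixV T | val x \in SpOrbit u)
          l x * rep_char sigma ((t (val x))^-1 * T * t (val x))%g in
        (forall g, g \in class_support (cl_column (Tagged _ l)) [set: _] ->
           rep_char (Pi_Cl sigma) g = value)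
        /\ (forall h, h \in class_support (asp_column (Tagged _ l)) [set: _] ->
           rep_char (Pi_ASp sigma) h = value)].
Proof.
have asp_carries u n (s : mx_representation R[i] (SpStab_group u) n) :
    carries (asp_extension R[i] A) (Pi_ASp s) s by exact: Pi_ASp_carries.
have cl_carries u n (s : mx_representation R[i] (SpStab_group u) n) :
    carries (cl_extension R[i] A) (Pi_Cl s) s by exact: F_repr_carries.
split.
- split; first exact: (rows_parametrized us_transversal cl_carries).
  exact: (rows_parametrized us_transversal asp_carries).
- split; first exact: (columns_parametrized (cl_extension R[i] A)).
  exact: (columns_parametrized (asp_extension R[i] A)).
move=> u n s T l t _ _ _ tP; split=> g.
  exact: (carries_column_char (cl_carries u n s) tP).
exact: (carries_column_char (asp_carries u n s) tP).
Qed.
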